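(* Let $F$ be a field of characteristic $2$, let $K=F(\sqrt{a_1},\dots,\sqrt{a_n})$ with $a_1,\dots,a_n\in F^*$, and let $L=K(\wp^{-1}(b))$ for some $b\in F$. Then $$W_q(K/F)=\sum_{i=1}^n\langle 1,a_i\rangle_b\otimes W_q(F),$$ $$W_q(L/F)=W(F)\otimes[1,b]+\sum_{i=1}^n\langle 1,a_i\rangle_b\otimes W_q(F).$$
   Context: $\wp^{-1}(b)$ denotes a root of $X^2+X+b$ (in an algebraic closure). $[a,b]$ denotes the quadratic form $ax^2+xy+by^2$. A quadratic form $q$ on a finite-dimensional vector space is nonsingular if its polar form $B_q(x,y)=q(x+y)+q(x)+q(y)$ has zero radical. $W_q(F)$ is the Witt group of nonsingular quadratic forms over $F$ (classes up to isometry and hyperbolic planes $[0,0]$, addition induced by $\perp$). It is a module over the Witt ring $W(F)$ of nonsingular symmetric bilinear forms over $F$, where $\langle a_1,\dots,a_n\rangle_b$ denotes the diagonal bilinear form with entries $a_i\in F^*$ and $\langle a_1,\dots,a_n\rangle_b\otimes q=a_1q\perp\dots\perp a_nq$. $W(F)\otimes[1,b]$ is the set of all classes $\beta\otimes[1,b]$ with $\beta\in W(F)$; sums are sums of subgroups of $W_q(F)$. For a field extension $E/F$, $W_q(E/F)$ is the kernel of the scalar extension map $W_q(F)\to W_q(E)$. *)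

(* Defs.v *)
From HB Require Import structures.
From mathcomp Require Import all_boot all_order all_algebra all_field.
From mathcomp Require Import boolp classical_sets.
From mathcomp.real_closed Require Import mxtens.
From mathcomp Require Import ring.
Set Implicit Arguments.
Unset Strict Implicit.
Unset Printing Implicit Defensive.
Import GRing.Theory.
Local Open Scope ring_scope.
Local Open Scope quotient_scope.

Notation "A *t B" := (tensmx A B)
  (at level 40, left associativity, format "A  *t  B") : ring_scope.

Section GramMatrices.
Variable F : fieldType.

(* Forms on F^n are given by matrices, acting on row vectors.  A quadratic form
   has many matrices (they differ by alternating ones); this ambiguity is
   absorbed by qisom, which compares values only. *)
Definition qf n (M : 'M[F]_n) (x : 'rV[F]_n) : F := (x *m M *m x^T) 0 0.
Definition qpolar n (M : 'M[F]_n) (x y : 'rV[F]_n) : F :=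
  qf M (x + y) - qf M x - qf M y.
Definition bf n (B : 'M[F]_n) (x y : 'rV[F]_n) : F := (x *m B *m y^T) 0 0.

Definition qnonsingular n (M : 'M[F]_n) : Prop :=
  forall x, (forall y, qpolar M x y = 0) -> x = 0.
Definition bnonsingular n (B : 'M[F]_n) : Prop :=
  forall x, (forall y, bf B x y = 0) -> x = 0.

Definition qisom m n (M : 'M[F]_m) (N : 'M[F]_n) : Prop :=
  exists2 f : {linear 'rV[F]_m -> 'rV[F]_n},
    bijective f & forall x, qf N (f x) = qf M x.
Definition bisom m n (B : 'M[F]_m) (C : 'M[F]_n) : Prop :=
  exists2 f : {linear 'rV[F]_m -> 'rV[F]_n},
    bijective f & forall x y, bf C (f x) (f y) = bf B x y.

Definition osum m n (M : 'M[F]_m) (N : 'M[F]_n) : 'M[F]_(m + n) :=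
  block_mx M 0 0 N.

(* x_1 y_1 + ... + x_k y_k, the orthogonal sum of k hyperbolic planes [0,0] *)
Definition hyp k : 'M[F]_(k + k) := block_mx 0 1%:M 0 0.

(* a symmetric bilinear form with a totally isotropic subspace (the row space
   of L) of half the dimension *)
Definition metabolic n (B : 'M[F]_n) : Prop :=
  exists k (L : 'M[F]_(k, n)), [/\ n = (k + k)%N, row_free L & L *m B *m L^T = 0].

(* a x^2 + x y + b y^2 *)
Definition bracket_mx (a b : F) : 'M[F]_(1 + 1) :=
  block_mx a%:M 1%:M 0 b%:M.

Definition diagb_mx (s : seq F) : 'M[F]_(size s) :=
  diag_mx (\row_(i < size s) s`_i).

Lemma mx11_tr (A : 'M[F]_1) : A^T 0 0 = A 0 0.
Proof. by rewrite mxE. Qed.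

Lemma qf_tr n (M : 'M[F]_n) x : qf M^T x = qf M x.
Proof. by rewrite /qf -[RHS]mx11_tr !trmx_mul trmxK mulmxA. Qed.

Lemma qfD n (M N : 'M[F]_n) x : qf (M + N) x = qf M x + qf N x.
Proof. by rewrite /qf mulmxDr mulmxDl mxE. Qed.

Lemma qfN n (M : 'M[F]_n) x : qf (- M) x = - qf M x.
Proof. by rewrite /qf mulmxN mulNmx mxE. Qed.

Lemma qfB n (M N : 'M[F]_n) x : qf (M - N) x = qf M x - qf N x.
Proof. by rewrite qfD qfN. Qed.

Lemma qf_mul m n (P : 'M[F]_(m, n)) (M : 'M[F]_n) x :
  qf M (x *m P) = qf (P *m M *m P^T) x.
Proof. by rewrite /qf trmx_mul !mulmxA. Qed.

Lemma bf_mul m n (P : 'M[F]_(m, n)) (M : 'M[F]_n) x y :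
  bf M (x *m P) (y *m P) = bf (P *m M *m P^T) x y.
Proof. by rewrite /bf trmx_mul !mulmxA. Qed.

Lemma qpolarE n (M : 'M[F]_n) x y : qpolar M x y = bf (M + M^T) x y.
Proof.
have -> : bf (M + M^T) x y = bf M x y + bf M y x.
  rewrite /bf mulmxDr mulmxDl mxE; congr (_ + _).
  by rewrite -[RHS]mx11_tr !trmx_mul trmxK mulmxA.
rewrite /qpolar /qf /bf linearD /= !mulmxDl !mulmxDr !mxE; ring.
Qed.

Lemma bf_delta n (B : 'M[F]_n) i j : bf B (delta_mx 0 i) (delta_mx 0 j) = B i j.
Proof. by rewrite /bf trmx_delta -rowE -colE !mxE. Qed.

Lemma bf0P n (B : 'M[F]_n) x : (forall y, bf B x y = 0) <-> x *m B = 0.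
Proof.
split=> [Bx|Bx y]; last by rewrite /bf Bx mul0mx mxE.
apply/rowP=> j; have := Bx (delta_mx 0 j).
by rewrite /bf trmx_delta -colE !mxE.
Qed.

Lemma bnonsingularP n (B : 'M[F]_n) : bnonsingular B <-> B \in unitmx.
Proof.
rewrite -row_free_unit -kermx_eq0; split=> [nsB|/eqP kB0 x /bf0P /sub_kermxP].
  apply/eqP/row_matrixP=> i; rewrite row0; apply/nsB/bf0P.
  by rewrite -row_mul mulmx_ker row0.
by rewrite kB0 submx0 => /eqP.
Qed.

Lemma qnonsingularP n (M : 'M[F]_n) : qnonsingular M <-> M + M^T \in unitmx.
Proof.
rewrite -bnonsingularP; split=> ns x Hx; apply: ns => y.
  by rewrite qpolarE.
by rewrite -qpolarE.
Qed.

Lemma qf0P n (D : 'M[F]_n) :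
  (forall x, qf D x = 0) <-> D^T = - D /\ forall i, D i i = 0.
Proof.
split=> [D0|[altD diagD] x].
  split=> [|i]; last by rewrite -(D0 (delta_mx 0 i)) -[LHS]bf_delta.
  apply/matrixP=> i j; rewrite !mxE; apply/eqP; rewrite -addr_eq0 addrC.
  have := qpolarE D (delta_mx 0 i) (delta_mx 0 j).
  by rewrite bf_delta /qpolar !D0 !subr0 !mxE => <-.
pose T := \matrix_(i, j) (D i j *+ (i < j)%N).
have -> : D = T - T^T.
  apply/matrixP=> i j; rewrite !mxE.
  case: (ltngtP i j) => [_|_|/val_inj ->].
  - by rewrite subr0.
  - by rewrite sub0r -[D i j]opprK; congr (- _); have := congr1 (fun A : 'M_n => A i j) altD; rewrite !mxE => ->.
  - by rewrite diagD subr0.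
by rewrite qfB qf_tr subrr.
Qed.

Lemma qisom_mx m n (M : 'M[F]_m) (N : 'M[F]_n) P Q :
  P *m Q = 1%:M -> Q *m P = 1%:M ->
  (forall x, qf N (x *m P) = qf M x) -> qisom M N.
Proof.
move=> PQ QP qP; exists (mulmxr P) => //.
by exists (mulmxr Q) => x /=; rewrite -mulmxA ?PQ ?QP mulmx1.
Qed.

Lemma bisom_mx m n (M : 'M[F]_m) (N : 'M[F]_n) P Q :
  P *m Q = 1%:M -> Q *m P = 1%:M -> P *m N *m P^T = M -> bisom M N.
Proof.
move=> PQ QP bP; exists (mulmxr P) => [|x y /=]; last by rewrite bf_mul bP.
by exists (mulmxr Q) => x /=; rewrite -mulmxA ?PQ ?QP mulmx1.
Qed.

Lemma linear_bij_mx m n (f : {linear 'rV[F]_m -> 'rV[F]_n}) : bijective f ->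
  exists P Q, [/\ P *m Q = 1%:M, Q *m P = 1%:M & forall x, f x = x *m P].
Proof.
case=> g fK gK; pose P := lin1_mx f.
have fP x : f x = x *m P by rewrite mul_rV_lin1.
pose Q := \matrix_i g (delta_mx 0 i).
have QP : Q *m P = 1%:M.
  by apply/row_matrixP=> i; rewrite row_mul rowK -fP gK row1.
exists P, Q; split=> //; apply/row_matrixP=> i; apply: (can_inj fK).
by rewrite !fP -!row_mul -mulmxA QP mulmx1 mul1mx.
Qed.

Lemma qisomP m n (M : 'M[F]_m) (N : 'M[F]_n) : qisom M N ->
  exists P Q, [/\ P *m Q = 1%:M, Q *m P = 1%:M
    & forall x, qf N (x *m P) = qf M x].
Proof.
case=> f /linear_bij_mx[P [Q [PQ QP fP]]] qM.
by exists P, Q; split=> // x; rewrite -fP.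
Qed.

Lemma bisomP m n (M : 'M[F]_m) (N : 'M[F]_n) : bisom M N ->
  exists P Q, [/\ P *m Q = 1%:M, Q *m P = 1%:M & P *m N *m P^T = M].
Proof.
case=> f /linear_bij_mx[P [Q [PQ QP fP]]] bM.
exists P, Q; split=> //; apply/matrixP=> i j.
by rewrite -!bf_delta -bf_mul -!fP.
Qed.

Lemma qisom_eq n (M N : 'M[F]_n) : (forall x, qf N x = qf M x) -> qisom M N.
Proof. by move=> MN; apply: (@qisom_mx _ _ _ _ 1%:M 1%:M); rewrite ?mulmx1 // => x; rewrite mulmx1. Qed.

Lemma qisom_refl n (M : 'M[F]_n) : qisom M M.
Proof. exact: qisom_eq. Qed.

Lemma qisom_sym m n (M : 'M[F]_m) (N : 'M[F]_n) : qisom M N -> qisom N M.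
Proof.
case/qisomP=> P [Q [PQ QP qM]]; apply: (qisom_mx QP PQ) => x.
by rewrite -qM -mulmxA QP mulmx1.
Qed.

Lemma qisom_trans m n p (M : 'M[F]_m) (N : 'M[F]_n) (R : 'M[F]_p) :
  qisom M N -> qisom N R -> qisom M R.
Proof.
case/qisomP=> P [Q [PQ QP qM]] /qisomP[P' [Q' [PQ' QP' qN]]].
apply: (@qisom_mx _ _ _ _ (P *m P') (Q' *m Q)) => [||x].
- by rewrite mulmxA -(mulmxA P) PQ' mulmx1.
- by rewrite mulmxA -(mulmxA Q') QP mulmx1.
- by rewrite mulmxA qN qM.
Qed.

Lemma bisom_refl n (M : 'M[F]_n) : bisom M M.
Proof. by apply: (@bisom_mx _ _ _ _ 1%:M 1%:M); rewrite ?(trmx1, mulmx1, mul1mx). Qed.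

Lemma bisom_sym m n (M : 'M[F]_m) (N : 'M[F]_n) : bisom M N -> bisom N M.
Proof.
case/bisomP=> P [Q [PQ QP <-]]; apply: (bisom_mx QP PQ).
by rewrite !mulmxA QP mul1mx -mulmxA -trmx_mul QP trmx1 mulmx1.
Qed.

Lemma bisom_trans m n p (M : 'M[F]_m) (N : 'M[F]_n) (R : 'M[F]_p) :
  bisom M N -> bisom N R -> bisom M R.
Proof.
case/bisomP=> P [Q [PQ QP <-]] /bisomP[P' [Q' [PQ' QP' <-]]].
apply: (@bisom_mx _ _ _ _ (P *m P') (Q' *m Q)).
- by rewrite mulmxA -(mulmxA P) PQ' mulmx1.
- by rewrite mulmxA -(mulmxA Q') QP mulmx1.
- by rewrite trmx_mul !mulmxA.
Qed.

Lemma bisom_qisom m n (M : 'M[F]_m) (N : 'M[F]_n) : bisom M N -> qisom M N.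
Proof.
case/bisomP=> P [Q [PQ QP <-]]; apply: (qisom_mx PQ QP) => x.
by rewrite qf_mul.
Qed.

Lemma bisom_reindex m n (M : 'M[F]_m) (N : 'M[F]_n) (s : 'I_m -> 'I_n) :
  bijective s -> (forall i j, N (s i) (s j) = M i j) -> bisom M N.
Proof.
case=> r sK rK NM.
pose P := \matrix_(i < m, j < n) ((s i == j)%:R : F).
pose Q := \matrix_(j < n, i < m) ((r j == i)%:R : F).
have rwP (i : 'I_m) : row i P = delta_mx 0 (s i).
  by apply/rowP=> j; rewrite !mxE eqxx eq_sym.
have rowQ (i : 'I_n) : row i Q = delta_mx 0 (r i).
  by apply/rowP=> j; rewrite !mxE eqxx eq_sym.
apply: (@bisom_mx _ _ _ _ P Q).
- by apply/row_matrixP=> i; rewrite row_mul rwP -rowE rowQ sK row1.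
- by apply/row_matrixP=> i; rewrite row_mul rowQ -rowE rwP rK row1.
- apply/matrixP=> i j; rewrite -NM -!bf_delta -bf_mul.
  by rewrite -!rowE !rwP.
Qed.

Lemma bisom_osum m m' n n' (M : 'M[F]_m) (M' : 'M[F]_m') (N : 'M[F]_n) (N' : 'M[F]_n') :
  bisom M M' -> bisom N N' -> bisom (osum M N) (osum M' N').
Proof.
case/bisomP=> P [Q [PQ QP <-]] /bisomP[P' [Q' [PQ' QP' <-]]].
apply: (@bisom_mx _ _ _ _ (block_mx P 0 0 P') (block_mx Q 0 0 Q')).
- by rewrite mulmx_block !mulmx0 !mul0mx !addr0 !add0r PQ PQ' -scalar_mx_block.
- by rewrite mulmx_block !mulmx0 !mul0mx !addr0 !add0r QP QP' -scalar_mx_block.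
- by rewrite /osum tr_block_mx !trmx0 !mulmx_block !(mulmx0, mul0mx, addr0, add0r).
Qed.

Lemma qf_osum m n (M : 'M[F]_m) (N : 'M[F]_n) x y :
  qf (osum M N) (row_mx x y) = qf M x + qf N y.
Proof.
by rewrite /qf mul_row_block !mulmx0 addr0 add0r tr_row_mx mul_row_col mxE.
Qed.

Lemma qisom_osum m m' n n' (M : 'M[F]_m) (M' : 'M[F]_m') (N : 'M[F]_n) (N' : 'M[F]_n') :
  qisom M M' -> qisom N N' -> qisom (osum M N) (osum M' N').
Proof.
case/qisomP=> P [Q [PQ QP qM]] /qisomP[P' [Q' [PQ' QP' qN]]].
apply: (@qisom_mx _ _ _ _ (block_mx P 0 0 P') (block_mx Q 0 0 Q')) => [||x].
- by rewrite mulmx_block !mulmx0 !mul0mx !addr0 !add0r PQ PQ' -scalar_mx_block.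
- by rewrite mulmx_block !mulmx0 !mul0mx !addr0 !add0r QP QP' -scalar_mx_block.
- rewrite -[x]hsubmxK mul_row_block !mulmx0 addr0 add0r.
  by rewrite !qf_osum qM qN.
Qed.

Lemma osumE m n (M : 'M[F]_m) (N : 'M[F]_n) (i j : 'I_m + 'I_n) :
  osum M N (unsplit i) (unsplit j) =
  match i, j with
  | inl i, inl j => M i j | inr i, inr j => N i j | _, _ => 0
  end.
Proof.
by case: i j => [i|i] [j|j] /=;
  rewrite ?(block_mxEul, block_mxEur, block_mxEdl, block_mxEdr) ?mxE.
Qed.

Lemma osumC m n (M : 'M[F]_m) (N : 'M[F]_n) : bisom (osum M N) (osum N M).
Proof.
pose c m n (i : 'I_(m + n)) : 'I_(n + m) :=
  unsplit (match split i with inl j => inr j | inr j => inl j end).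
have cK p q : cancel (c p q) (c q p).
  by move=> i; rewrite /c unsplitK -[RHS]splitK; case: (split i).
apply: (@bisom_reindex _ _ _ _ (c m n)) => [|i j]; first by exists (c n m).
rewrite /c osumE -[in RHS](splitK i) -[in RHS](splitK j) osumE.
by case: (split i) (split j) => [?|?] [].
Qed.

Lemma bisom_cast m n (e : m = n) (M : 'M[F]_m) : bisom (castmx (e, e) M) M.
Proof. by case: n / e; rewrite castmx_id; apply: bisom_refl. Qed.

Lemma osumA m n p (M : 'M[F]_m) (N : 'M[F]_n) (R : 'M[F]_p) :
  bisom (osum M (osum N R)) (osum (osum M N) R).
Proof.
have -> : osum M (osum N R) =
    castmx (esym (addnA m n p), esym (addnA m n p)) (osum (osum M N) R).
  by rewrite /osum -[X in block_mx M X]row_mx0 -[X in block_mx M _ X]col_mx0 block_mxA row_mx0 col_mx0.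
exact: bisom_cast.
Qed.

Lemma osum0 n (M : 'M[F]_n) (Z : 'M[F]_0) : bisom (osum Z M) M.
Proof.
apply: (@bisom_reindex _ _ _ _ (fun i => i)) => [|i j]; first by exists id.
have e (k : 'I_n) : k = unsplit (inr k) :> 'I_(0 + n) by apply: val_inj.
by rewrite [in RHS](e i) [in RHS](e j) osumE.
Qed.

Lemma row_free_complete k (L : 'M[F]_(k, k + k)) : row_free L ->
  exists R : 'M_(k, k + k), col_mx L R \in unitmx.
Proof.
move=> /eqP rL; have rC : \rank (L^C)%MS = k by rewrite mxrank_compl rL addnK.
exists (castmx (rC, erefl) (row_base L^C)%MS).
rewrite -row_full_unit -sub1mx -addsmxE.
have cC : (L^C <= castmx (rC, erefl) (row_base L^C))%MS.
  by rewrite eqmx_cast eq_row_base.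
by apply: submx_trans (addsmxS (submx_refl L) cC); rewrite sub1mx addsmx_compl_full.
Qed.

Lemma lagrangian_hyp k n (M : 'M[F]_n) (L : 'M[F]_(k, n)) :
  qnonsingular M -> n = (k + k)%N -> row_free L ->
  (forall x, qf M (x *m L) = 0) -> qisom M (hyp k).
Proof.
move=> /qnonsingularP + en; subst n => uM fL qL.
have [R uP] := row_free_complete fL; set P := col_mx L R in uP.
pose N := P *m M *m P^T.
have MN : qisom N M.
  apply: (@qisom_mx _ _ _ _ P (invmx P)) => [||x]; rewrite ?mulmxV ?mulVmx //.
  by rewrite qf_mul.
apply: qisom_trans (qisom_sym MN) _.
have uN : N + N^T \in unitmx.
  rewrite /N !trmx_mul trmxK mulmxA -mulmxDl -mulmxDr !unitmx_mul unitmx_tr uP.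
  by rewrite uM.
have N11 : forall x, qf (ulsubmx N) x = 0.
  move=> x; rewrite -(qL x) qf_mul; congr (qf _ x).
  by rewrite /N mul_col_mx tr_col_mx mul_col_row block_mxKul.
have [tN11 _] := (qf0P _).1 N11.
pose U := ursubmx N + (dlsubmx N)^T.
have uU : U \in unitmx.
  move: uN; rewrite -[N]submxK tr_block_mx add_block_mx tN11 subrr.
  rewrite -/U; have -> : dlsubmx N + (ursubmx N)^T = U^T.
    by rewrite /U linearD /= trmxK addrC.
  move=> uB; rewrite -row_free_unit -kermx_eq0.
  have : row_mx (kermx U) 0 *m block_mx 0 U U^T (drsubmx N + (drsubmx N)^T) = 0 :> 'M_(k, k + k).
    by rewrite mul_row_block !(mulmx0, mul0mx, addr0, add0r) mulmx_ker row_mx0.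
  move/(congr1 (mulmx^~ (invmx (block_mx 0 U U^T (drsubmx N + (drsubmx N)^T))))).
  by rewrite mul0mx mulmxK // => /eqP; rewrite row_mx_eq0 => /andP[].
pose V := block_mx U 0 (drsubmx N) 1%:M.
have uV : V \in unitmx.
  rewrite unitmxE det_lblock det1 mulr1 -unitmxE; exact: uU.
apply: (@qisom_mx _ _ _ _ V (invmx V)) => [||x]; rewrite ?mulmxV ?mulVmx //.
apply/eqP; rewrite qf_mul -subr_eq0 -qfB; apply/eqP; move: x; apply/qf0P.
have -> : V *m hyp k *m V^T - N =
    block_mx (- ulsubmx N) ((dlsubmx N)^T) (- dlsubmx N) 0.
  rewrite -[X in _ - X]submxK /V /hyp tr_block_mx !mulmx_block.
  rewrite !(mulmx0, mul0mx, addr0, add0r, trmx0, trmx1, mulmx1, mul1mx).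
  by rewrite opp_block_mx add_block_mx !add0r subrr addrAC subrr add0r.
split.
  rewrite tr_block_mx opp_block_mx trmxK trmx0 oppr0 !opprK linearN /= tN11.
  by rewrite opprK linearN.
have [_ dN11] := (qf0P _).1 N11.
move=> i; rewrite -(splitK i); case: (split i) => j /=.
  by rewrite block_mxEul mxE dN11 oppr0.
by rewrite block_mxEdr mxE.
Qed.

Lemma hyp_nonsingular k : qnonsingular (hyp k).
Proof.
apply/qnonsingularP; rewrite /hyp tr_block_mx !trmx0 trmx1 add_block_mx.
rewrite !addr0 add0r; set H := block_mx _ _ _ _.
have /mulmx1_unit[] // : H *m H = 1%:M.
by rewrite mulmx_block !(mulmx0, mul0mx, addr0, add0r, mulmx1) -scalar_mx_block.
Qed.

Lemma qnonsingular_osum m n (M : 'M[F]_m) (N : 'M[F]_n) :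
  qnonsingular M -> qnonsingular N -> qnonsingular (osum M N).
Proof.
move=> nM nN x Hx; rewrite -[x]hsubmxK; rewrite -[x]hsubmxK in Hx.
have -> : lsubmx x = 0.
  apply: nM => y; have := Hx (row_mx y 0).
  rewrite /qpolar add_row_mx addr0 !qf_osum.
  have -> : qf N 0 = 0 by rewrite /qf !mul0mx mxE.
  by move=> <-; ring.
have -> : rsubmx x = 0; last exact: row_mx0.
apply: nN => y; have := Hx (row_mx 0 y).
rewrite /qpolar add_row_mx addr0 !qf_osum.
have -> : qf M 0 = 0 by rewrite /qf !mul0mx mxE.
by move=> <-; ring.
Qed.

Lemma hypD i j : qisom (osum (hyp i) (hyp j)) (hyp (i + j)).
Proof.
pose R k : 'M[F]_(k, k + k) := row_mx 1%:M 0.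
apply: (@lagrangian_hyp _ _ _ (block_mx (R i) 0 0 (R j))).
- by apply: qnonsingular_osum; apply: hyp_nonsingular.
- by rewrite addnACA.
- have RR k : R k *m (R k)^T = 1%:M.
    by rewrite /R tr_row_mx mul_row_col trmx1 trmx0 mulmx1 mulmx0 addr0.
  apply/row_freeP; exists (block_mx (R i)^T 0 0 (R j)^T).
  by rewrite mulmx_block !(mulmx0, mul0mx, addr0, add0r) !RR -scalar_mx_block.
- have R0 k x : qf (hyp k) (x *m R k) = 0.
    rewrite qf_mul /R /hyp mul_row_block tr_row_mx mul_row_col.
    by rewrite !(mulmx0, mul0mx, addr0, add0r, trmx0) /qf mulmx0 mul0mx mxE.
  move=> x; rewrite -[x]hsubmxK mul_row_block !(mulmx0, addr0, add0r) qf_osum.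
  by rewrite !R0 addr0.
Qed.

Lemma osumN_hyp n (M : 'M[F]_n) : qnonsingular M -> qisom (osum (- M) M) (hyp n).
Proof.
move=> nM; apply: (@lagrangian_hyp _ _ _ (row_mx 1%:M 1%:M)) => //.
- apply: qnonsingular_osum => // x Hx; apply: nM => y.
  by apply: oppr_inj; rewrite oppr0 -(Hx y) /qpolar !qfN; ring.
- apply/row_freeP; exists (col_mx 1%:M 0).
  by rewrite mul_row_col mulmx1 mulmx0 addr0.
- by move=> x; rewrite mul_mx_row mulmx1 qf_osum qfN addNr.
Qed.

Lemma qnonsingular_isom m n (M : 'M[F]_m) (N : 'M[F]_n) :
  qisom M N -> qnonsingular M -> qnonsingular N.
Proof.
case/qisomP=> P [Q [PQ QP qM]] nM x Hx.
rewrite -[x]mulmx1 -QP mulmxA [x *m Q]nM ?mul0mx // => y.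
by rewrite -(Hx (y *m P)) /qpolar -!qM mulmxDl -mulmxA QP mulmx1.
Qed.

Lemma qf_tens_alt m n (B : 'M[F]_m) (D : 'M[F]_n) : B^T = B ->
  (forall x, qf D x = 0) -> forall x, qf (B *t D) x = 0.
Proof.
move=> symB /qf0P[altD dD]; apply/qf0P; split.
  by rewrite trmx_tens symB altD; apply/matrixP=> i j; rewrite !mxE mulrN.
by move=> i; rewrite mxE dD mulr0.
Qed.

Lemma tensmx11 m n : (1%:M : 'M[F]_m) *t (1%:M : 'M[F]_n) = 1%:M.
Proof.
apply/matrixP=> i j; case: (mxtens_indexP i) => i1 i2.
case: (mxtens_indexP j) => j1 j2; rewrite tensmxE !mxE -natrM mulnb.
by rewrite (can_eq (@mxtens_indexK m n)) xpair_eqE.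
Qed.

Lemma qisom_tens m n n' (B : 'M[F]_m) (M : 'M[F]_n) (N : 'M[F]_n') : B^T = B ->
  qisom M N -> qisom (B *t M) (B *t N).
Proof.
move=> symB /qisomP[P [Q [PQ QP qM]]].
apply: (@qisom_mx _ _ _ _ (1%:M *t P) (1%:M *t Q)) => [||x].
- by rewrite tensmx_mul mulmx1 PQ tensmx11.
- by rewrite tensmx_mul mulmx1 QP tensmx11.
- apply/eqP; rewrite qf_mul -subr_eq0 -qfB; apply/eqP.
  rewrite trmx_tens trmx1 !tensmx_mul mul1mx mulmx1.
  have -> : B *t (P *m N *m P^T) - B *t M = B *t (P *m N *m P^T - M).
    by apply/matrixP=> i j; rewrite !mxE mulrBr.
  by apply: qf_tens_alt => // y; rewrite qfB -qf_mul qM subrr.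
Qed.

Lemma bisom_tensl m m' n (B : 'M[F]_m) (C : 'M[F]_m') (M : 'M[F]_n) :
  bisom B C -> bisom (B *t M) (C *t M).
Proof.
case/bisomP=> P [Q [PQ QP <-]].
apply: (@bisom_mx _ _ _ _ (P *t 1%:M) (Q *t 1%:M)).
- by rewrite tensmx_mul mulmx1 PQ tensmx11.
- by rewrite tensmx_mul mulmx1 QP tensmx11.
- by rewrite trmx_tens trmx1 !tensmx_mul mul1mx mulmx1.
Qed.

Local Opaque mxtens_unindex.
Local Arguments unsplit : simpl never.

Lemma tens_osuml m1 m2 n (B : 'M[F]_m1) (C : 'M[F]_m2) (M : 'M[F]_n) :
  bisom (osum B C *t M) (osum (B *t M) (C *t M)).
Proof.
pose s (k : 'I_((m1 + m2) * n)) : 'I_(m1 * n + m2 * n) :=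
  let ij := mxtens_unindex k in
  unsplit (match split ij.1 with
           | inl i => inl (mxtens_index (i, ij.2))
           | inr i => inr (mxtens_index (i, ij.2)) end).
pose r (k : 'I_(m1 * n + m2 * n)) : 'I_((m1 + m2) * n) :=
  mxtens_index (match split k with
    | inl l => (unsplit (inl (mxtens_unindex l).1), (mxtens_unindex l).2)
    | inr l => (unsplit (inr (mxtens_unindex l).1), (mxtens_unindex l).2) end).
apply: (@bisom_reindex _ _ _ _ s) => [|k l].
  exists r => k; rewrite /s /r.
    rewrite unsplitK; case: (mxtens_indexP k) => i j; rewrite mxtens_indexK /=.
    by case: (split i) (splitK i) => l /= <-; rewrite mxtens_indexK.
  rewrite mxtens_indexK -[RHS]splitK; case: (split k) => l /=;
  by rewrite unsplitK /= -surjective_pairing mxtens_unindexK.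
case: (mxtens_indexP k) => i j; case: (mxtens_indexP l) => i' j'.
rewrite tensmxE /s !mxtens_indexK /= osumE -[in RHS](splitK i) -[in RHS](splitK i') osumE.
by case: (split i) (split i') => [?|?] [?|?]; rewrite ?tensmxE ?mul0r.
Qed.

Lemma tens_osumr m n1 n2 (B : 'M[F]_m) (M : 'M[F]_n1) (N : 'M[F]_n2) :
  bisom (B *t osum M N) (osum (B *t M) (B *t N)).
Proof.
pose s (k : 'I_(m * (n1 + n2))) : 'I_(m * n1 + m * n2) :=
  let ij := mxtens_unindex k in
  unsplit (match split ij.2 with
           | inl j => inl (mxtens_index (ij.1, j))
           | inr j => inr (mxtens_index (ij.1, j)) end).
pose r (k : 'I_(m * n1 + m * n2)) : 'I_(m * (n1 + n2)) :=
  mxtens_index (match split k with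
    | inl l => ((mxtens_unindex l).1, unsplit (inl (mxtens_unindex l).2))
    | inr l => ((mxtens_unindex l).1, unsplit (inr (mxtens_unindex l).2)) end).
apply: (@bisom_reindex _ _ _ _ s) => [|k l].
  exists r => k; rewrite /s /r.
    rewrite unsplitK; case: (mxtens_indexP k) => i j; rewrite mxtens_indexK /=.
    by case: (split j) (splitK j) => l /= <-; rewrite mxtens_indexK.
  rewrite mxtens_indexK -[RHS]splitK; case: (split k) => l /=;
  by rewrite unsplitK /= -surjective_pairing mxtens_unindexK.
case: (mxtens_indexP k) => i j; case: (mxtens_indexP l) => i' j'.
rewrite tensmxE /s !mxtens_indexK /= osumE -[in RHS](splitK j) -[in RHS](splitK j') osumE.
by case: (split j) (split j') => [?|?] [?|?]; rewrite ?tensmxE ?mulr0.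
Qed.

Local Transparent mxtens_unindex.

Lemma qnonsingular_tens m n (B : 'M[F]_m) (M : 'M[F]_n) :
  B^T = B -> bnonsingular B -> qnonsingular M -> qnonsingular (B *t M).
Proof.
move=> symB /bnonsingularP uB /qnonsingularP uM; apply/qnonsingularP.
have -> : B *t M + (B *t M)^T = B *t (M + M^T).
  by rewrite trmx_tens symB; apply/matrixP=> i j; rewrite !mxE mulrDr.
have [] // := @mulmx1_unit _ _ (B *t (M + M^T)) (invmx B *t invmx (M + M^T)).
by rewrite tensmx_mul !mulmxV // tensmx11.
Qed.

Lemma bf_tens m n (B : 'M[F]_m) (C : 'M[F]_n) (x x' : 'rV_m) (y y' : 'rV_n) :
  bf (B *t C) (x *t y) (x' *t y') = bf B x x' * bf C y y'.
Proof.
have e : (x *t y) *m (B *t C) *m (x' *t y')^T =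
    (x *m B *m x'^T) *t (y *m C *m y'^T) by rewrite trmx_tens !tensmx_mul.
rewrite /bf; transitivity (((x *m B *m x'^T) *t (y *m C *m y'^T)) 0 0).
  by rewrite -e.
rewrite mxE.
rewrite (ord1 (mxtens_unindex (0 : 'I_(1 * 1))).1).
by rewrite (ord1 (mxtens_unindex (0 : 'I_(1 * 1))).2).
Qed.

Lemma qf_tens m n (B : 'M[F]_m) (M : 'M[F]_n) (x : 'rV_m) (y : 'rV_n) :
  qf (B *t M) (x *t y) = bf B x x * qf M y.
Proof. exact: bf_tens. Qed.

Lemma qpolar_tens m n (B : 'M[F]_m) (M : 'M[F]_n)
    (x x' : 'rV_m) (y y' : 'rV_n) : B^T = B ->
  qpolar (B *t M) (x *t y) (x' *t y') = bf B x x' * qpolar M y y'.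
Proof.
move=> symB; rewrite !qpolarE -bf_tens; congr bf.
by rewrite trmx_tens symB; apply/matrixP=> i j; rewrite !mxE mulrDr.
Qed.

Lemma tens_hyp m k (B : 'M[F]_m) : B^T = B -> bnonsingular B ->
  qisom (B *t hyp k) (hyp (m * k)).
Proof.
move=> symB nB; apply: (@lagrangian_hyp _ _ _ (1%:M *t row_mx 1%:M 0)).
- by apply: qnonsingular_tens => //; apply: hyp_nonsingular.
- by rewrite mulnDr.
- apply/row_freeP; exists (1%:M *t col_mx 1%:M 0).
  by rewrite tensmx_mul mul_row_col mulmx1 mulmx0 addr0 mulmx1 tensmx11.
- move=> x; rewrite qf_mul trmx_tens !tensmx_mul /hyp mul_row_block tr_row_mx mul_row_col.
  rewrite !(mulmx0, mul0mx, addr0, add0r, trmx0) tensmx0.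
  by rewrite /qf mulmx0 mul0mx mxE.
Qed.

Lemma metabolic_tens m n (B : 'M[F]_m) (M : 'M[F]_n) :
  B^T = B -> bnonsingular B -> metabolic B -> qnonsingular M ->
  exists k, qisom (B *t M) (hyp k).
Proof.
move=> symB nB [k [L [em /row_freeP[L' LL'] LB]]] nM; exists (k * n)%N.
apply: (@lagrangian_hyp _ _ _ (L *t 1%:M)).
- exact: qnonsingular_tens.
- by rewrite em mulnDl.
- by apply/row_freeP; exists (L' *t 1%:M); rewrite tensmx_mul LL' mulmx1 tensmx11.
- move=> x; rewrite qf_mul trmx_tens !tensmx_mul LB tens0mx.
  by rewrite /qf mulmx0 mul0mx mxE.
Qed.

Lemma metabolic_osum m n (B : 'M[F]_m) (C : 'M[F]_n) :
  metabolic B -> metabolic C -> metabolic (osum B C).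
Proof.
move=> [k [L [em /row_freeP[L' LL'] LB]]] [l [K [en /row_freeP[K' KK'] KC]]].
exists (k + l)%N, (block_mx L 0 0 K); split; first by rewrite em en addnACA.
  apply/row_freeP; exists (block_mx L' 0 0 K').
  by rewrite mulmx_block !(mulmx0, mul0mx, addr0, add0r) LL' KK' -scalar_mx_block.
rewrite /osum tr_block_mx !mulmx_block !trmx0 !(mulmx0, mul0mx, addr0, add0r).
by rewrite LB KC block_mx0.
Qed.

Lemma bnonsingular_osum m n (B : 'M[F]_m) (C : 'M[F]_n) :
  bnonsingular B -> bnonsingular C -> bnonsingular (osum B C).
Proof.
move=> /bnonsingularP uB /bnonsingularP uC; apply/bnonsingularP.
have [] // := @mulmx1_unit _ _ (osum B C) (osum (invmx B) (invmx C)).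
rewrite mulmx_block !(mulmx0, mul0mx, addr0, add0r) !mulmxV //.
by rewrite -scalar_mx_block.
Qed.

Lemma osum_tr m n (B : 'M[F]_m) (C : 'M[F]_n) :
  B^T = B -> C^T = C -> (osum B C)^T = osum B C.
Proof. by move=> sB sC; rewrite tr_block_mx !trmx0 sB sC. Qed.

Lemma qf_bracket a b x y :
  qf (bracket_mx a b) (row_mx x%:M y%:M) = a * x ^+ 2 + x * y + b * y ^+ 2.
Proof.
rewrite /qf /bracket_mx mul_row_block tr_row_mx mul_row_col !tr_scalar_mx.
by rewrite !(mulmx0, addr0, mulmx1) mulmxDl -!scalar_mxM !mxE !mulr1n; ring.
Qed.

Lemma bracket_nonsingular (F2 : 2%N \in [pchar F]) a b :
  qnonsingular (bracket_mx a b).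
Proof.
have char2 (c : F) : c + c = 0 by rewrite addrr_pchar2.
apply/qnonsingularP; rewrite /bracket_mx tr_block_mx !tr_scalar_mx trmx0.
rewrite add_block_mx -!raddfD /= !char2 addr0 add0r.
set H := block_mx _ _ _ _; have [] // := @mulmx1_unit _ _ H H.
by rewrite /H mulmx_block -!scalar_mxM !(mulr0, mul0r, mulr1, raddf0, mulmx1, mul0mx, mulmx0, addr0, add0r) -scalar_mx_block.
Qed.

Lemma diagb_sym s : (diagb_mx s)^T = diagb_mx s.
Proof. exact: tr_diag_mx. Qed.

Lemma diagb_nonsingular s : all (fun a => a != 0) s -> bnonsingular (diagb_mx s).
Proof.
move=> /allP s0; apply/bnonsingularP; rewrite unitmxE det_diag unitfE.
by apply/prodf_neq0 => i _; rewrite mxE s0 // mem_nth.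
Qed.

(* Iterated, this is <a_1, ..., a_m>_b (x) q = a_1 q _|_ ... _|_ a_m q. *)
Lemma tens_diagb_cons a s n (M : 'M[F]_n) :
  bisom (diagb_mx (a :: s) *t M) (osum (a *: M) (diagb_mx s *t M)).
Proof.
have -> : diagb_mx (a :: s) = osum (a%:M : 'M_1) (diagb_mx s).
  have -> : a%:M = diag_mx (a%:M : 'rV_1) by apply/matrixP=> i j; rewrite !ord1 !mxE.
  rewrite /osum -diag_mx_row; congr diag_mx; apply/rowP=> i.
  rewrite !mxE; case: (splitP (i : 'I_(1 + size s))) => k ek; rewrite !mxE ek.
    by rewrite !ord1.
  by [].
apply: (bisom_trans (tens_osuml (a%:M : 'M_1) (diagb_mx s) M)); apply: bisom_osum (bisom_refl _).
by rewrite tens_scalar_mx; apply: bisom_cast.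
Qed.
End GramMatrices.

Section MapForms.
Variables (F E : fieldType) (f : {rmorphism F -> E}).

Lemma map_qnonsingular n (M : 'M[F]_n) :
  qnonsingular M -> qnonsingular (map_mx f M).
Proof.
move=> /qnonsingularP uM; apply/qnonsingularP.
by rewrite map_trmx -map_mxD map_unitmx.
Qed.

Lemma map_qisom m n (M : 'M[F]_m) (N : 'M[F]_n) :
  qisom M N -> qisom (map_mx f M) (map_mx f N).
Proof.
case/qisomP=> P [Q [PQ QP qM]].
apply: (@qisom_mx _ _ _ _ _ (map_mx f P) (map_mx f Q)) => [||x].
- by rewrite -map_mxM PQ map_mx1.
- by rewrite -map_mxM QP map_mx1.
- apply/eqP; rewrite qf_mul -subr_eq0 -qfB; apply/eqP; move: x; apply/qf0P.
  have /qf0P[altD dD] : forall x, qf (P *m N *m P^T - M) x = 0.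
    by move=> x; rewrite qfB -qf_mul qM subrr.
  rewrite map_trmx -!map_mxM -map_mxB; split=> [|i].
    by rewrite map_trmx altD map_mxN.
  by rewrite mxE dD; apply: raddf0.
Qed.

Lemma map_osum m n (M : 'M[F]_m) (N : 'M[F]_n) :
  map_mx f (osum M N) = osum (map_mx f M) (map_mx f N).
Proof. by rewrite /osum map_block_mx !map_mx0. Qed.

Lemma map_hyp k : map_mx f (hyp F k) = hyp E k.
Proof. by rewrite /hyp map_block_mx !map_mx0 map_mx1. Qed.
End MapForms.

Record qform (F : fieldType) := QForm {
  qdim : nat;
  qmx :> 'M[F]_qdim;
  qformP : qnonsingular qmx }.

Record bform (F : fieldType) := BForm {
  bdim : nat;
  bmx :> 'M[F]_bdim;
  bform_sym : bmx^T = bmx;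
  bformP : bnonsingular bmx }.

Arguments qformP {F} q x _ : rename.
Arguments bformP {F} B x _ : rename.

HB.instance Definition _ F := gen_eqMixin (qform F).
HB.instance Definition _ F := gen_choiceMixin (qform F).
HB.instance Definition _ F := gen_eqMixin (bform F).
HB.instance Definition _ F := gen_choiceMixin (bform F).

Section WittGroups.
Variable F : fieldType.
Implicit Types (p q r : qform F) (B C : bform F).

Definition qsum p q := QForm (qnonsingular_osum (qformP p) (qformP q)).
Definition qhyp k := QForm (@hyp_nonsingular F k).

Lemma qopp_subproof q : qnonsingular (- qmx q).
Proof.
move=> x Hx; apply: (@qformP _ q) => y.
by apply: oppr_inj; rewrite oppr0 -(Hx y) /qpolar !qfN; ring.
Qed.
Definition qopp q := QForm (@qopp_subproof q).

(* For B symmetric, the Kronecker product is a matrix of the quadratic form with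
   (x (x) y) |-> B(x, x) q(y) and polar form the tensor product of B with the
   polar form of q; see qf_tens and qpolar_tens. *)
Definition qtens B q :=
  QForm (qnonsingular_tens (bform_sym B) (bformP B) (qformP q)).

Definition bracket (F2 : 2%N \in [pchar F]) (a b : F) : qform F :=
  QForm (@bracket_nonsingular F F2 a b).

Definition diagb (s : seq F) (s0 : all (fun a => a != 0) s) : bform F :=
  BForm (diagb_sym s) (@diagb_nonsingular F s s0).

Definition qwitt p q : Prop :=
  exists i j, qisom (osum p (hyp F i)) (osum q (hyp F j)).

Definition bwitt B C : Prop :=
  exists (U V : bform F),
    [/\ metabolic U, metabolic V & bisom (osum B U) (osum C V)].

Lemma qisom_qwitt p q : qisom p q -> qwitt p q.
Proof. by exists 0, 0; apply: qisom_osum (qisom_refl _). Qed.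

Lemma qwitt_sym p q : qwitt p q -> qwitt q p.
Proof. by case=> i [j e]; exists j, i; apply: qisom_sym. Qed.

Lemma qosumA m n k (M : 'M[F]_m) (N : 'M[F]_n) (R : 'M[F]_k) :
  qisom (osum M (osum N R)) (osum (osum M N) R).
Proof. exact/bisom_qisom/osumA. Qed.

Lemma qosumC m n (M : 'M[F]_m) (N : 'M[F]_n) : qisom (osum M N) (osum N M).
Proof. exact/bisom_qisom/osumC. Qed.

Lemma qosum_hypD m (M : 'M[F]_m) i j :
  qisom (osum (osum M (hyp F i)) (hyp F j)) (osum M (hyp F (i + j))).
Proof.
apply: qisom_trans (qisom_sym (qosumA _ _ _)) _.
exact: qisom_osum (qisom_refl _) (hypD _ _ _).
Qed.

Lemma qwitt_trans p q r : qwitt p q -> qwitt q r -> qwitt p r.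
Proof.
case=> i [j pq] [k [l qr]]; exists (i + k)%N, (l + j)%N.
apply: qisom_trans (qisom_sym (qosum_hypD _ _ _)) _.
apply: qisom_trans (qisom_osum pq (qisom_refl _)) _.
apply: qisom_trans (qosum_hypD _ _ _) _; rewrite (addnC j k).
apply: qisom_trans (qisom_sym (qosum_hypD _ _ _)) _.
apply: qisom_trans (qisom_osum qr (qisom_refl _)) _.
exact: qosum_hypD.
Qed.

Lemma qwittW p q i : qisom p (osum q (hyp F i)) -> qwitt p q.
Proof.
move=> e; exists 0, i; apply: qisom_trans e; apply: qisom_trans (qosumC _ _) _.
exact/bisom_qisom/osum0.
Qed.

Lemma qosumCA m n k (M : 'M[F]_m) (N : 'M[F]_n) (R : 'M[F]_k) :
  qisom (osum (osum M N) R) (osum (osum M R) N).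
Proof.
apply: qisom_trans (qisom_sym (qosumA _ _ _)) _.
apply: qisom_trans (qisom_osum (qisom_refl _) (qosumC _ _)) _.
exact: qosumA.
Qed.

Lemma qwitt_suml p p' q : qwitt p p' -> qwitt (qsum p q) (qsum p' q).
Proof.
case=> i [j e]; exists i, j; apply: qisom_trans (qosumCA _ _ _) _.
apply: qisom_trans (qosumCA _ _ _).
exact: qisom_osum e (qisom_refl _).
Qed.

Lemma qwitt_sumC p q : qwitt (qsum p q) (qsum q p).
Proof. exact/qisom_qwitt/qosumC. Qed.

Lemma qwitt_sum p p' q q' :
  qwitt p p' -> qwitt q q' -> qwitt (qsum p q) (qsum p' q').
Proof.
move=> pp' qq'; apply: qwitt_trans (qwitt_suml q pp') _.
apply: qwitt_trans (qwitt_sumC _ _) _.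
apply: qwitt_trans (qwitt_suml p' qq') _; exact: qwitt_sumC.
Qed.

Lemma qwitt_opp p p' : qwitt p p' -> qwitt (qopp p) (qopp p').
Proof.
case=> i [j e].
have oppH k : qisom (- hyp F k) (hyp F k).
  apply: (@lagrangian_hyp _ _ _ _ (row_mx 1%:M 0)) => //.
  - exact: (@qopp_subproof (qhyp k)).
  - apply/row_freeP; exists (col_mx 1%:M 0).
    by rewrite mul_row_col mulmx1 mulmx0 addr0.
  - move=> x; rewrite qfN qf_mul /hyp mul_row_block tr_row_mx mul_row_col.
    rewrite !(mulmx0, mul0mx, addr0, add0r, trmx0).
    by rewrite /qf mulmx0 mul0mx mxE oppr0.
have oppD m n (M : 'M[F]_m) (N : 'M[F]_n) : - osum M N = osum (- M) (- N).
  by rewrite opp_block_mx !oppr0.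
exists i, j; apply: qisom_trans (qisom_osum (qisom_refl _) (qisom_sym (oppH i))) _.
apply: qisom_trans (qisom_osum (qisom_refl _) (oppH j)).
rewrite -!oppD; case/qisomP: e => P [Q [PQ QP qM]].
by apply: (qisom_mx PQ QP) => x; rewrite !qfN qM.
Qed.

Lemma bwitt_sym B C : bwitt B C -> bwitt C B.
Proof. by case=> U [V [mU mV e]]; exists V, U; split=> //; apply: bisom_sym. Qed.

Definition bsum B C :=
  BForm (osum_tr (bform_sym B) (bform_sym C))
        (bnonsingular_osum (bformP B) (bformP C)).

Lemma bosumCA m n k (M : 'M[F]_m) (N : 'M[F]_n) (R : 'M[F]_k) :
  bisom (osum M (osum N R)) (osum (osum M R) N).
Proof.
apply: bisom_trans (bisom_osum (bisom_refl _) (osumC _ _)) _.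
exact: osumA.
Qed.

Lemma bwitt_trans B C D : bwitt B C -> bwitt C D -> bwitt B D.
Proof.
case=> U [V [mU mV BC]] [U' [V' [mU' mV' CD]]].
exists (bsum U U'), (bsum V' V); split; try exact: metabolic_osum.
apply: bisom_trans (osumA _ _ _) _.
apply: bisom_trans (bisom_osum BC (bisom_refl _)) _.
apply: bisom_trans (bisom_sym (osumA _ _ _)) _.
apply: bisom_trans (bosumCA _ _ _) _.
apply: bisom_trans (bisom_osum CD (bisom_refl _)) _.
exact: bisom_sym (osumA _ _ _).
Qed.

Lemma bwitt_refl B : bwitt B B.
Proof.
have s0 : all (fun a : F => a != 0) [::] by [].
have m0 : metabolic (diagb s0).
  exists 0, 0; split=> //; first by rewrite /row_free mxrank0.
  by apply/matrixP=> -[].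
by exists (diagb s0), (diagb s0); split=> //; apply: bisom_refl.
Qed.

Lemma qwitt_tensr B q q' : qwitt q q' -> qwitt (qtens B q) (qtens B q').
Proof.
case=> i [j e]; exists (bdim B * i)%N, (bdim B * j)%N.
have sB := bform_sym B; have tH k := tens_hyp k sB (bformP B).
have step k r : qisom (osum (qtens B r) (hyp F (bdim B * k)))
    (B *t osum r (hyp F k)).
  apply: qisom_trans (qisom_osum (qisom_refl _) (qisom_sym (tH k))) _.
  exact/qisom_sym/bisom_qisom/tens_osumr.
apply: qisom_trans (step _ _) _; apply: qisom_trans (qisom_sym (step _ _)).
exact: qisom_tens.
Qed.

Lemma qwitt_tensl B C q : bwitt B C -> qwitt (qtens B q) (qtens C q).
Proof.
case=> U [V [mU mV e]].
have [k Uk] := metabolic_tens (bform_sym U) (bformP U) mU (qformP q).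
have [l Vl] := metabolic_tens (bform_sym V) (bformP V) mV (qformP q).
exists k, l.
apply: qisom_trans (qisom_osum (qisom_refl _) (qisom_sym Uk)) _.
apply: qisom_trans (qisom_osum (qisom_refl _) Vl).
apply: qisom_trans (qisom_sym (bisom_qisom (tens_osuml _ _ _))) _.
apply: qisom_trans (bisom_qisom (tens_osuml _ _ _)).
exact/bisom_qisom/bisom_tensl.
Qed.

Lemma qwitt_equiv_subproof : equiv_class_of (fun p q => `[< qwitt p q >]).
Proof.
split=> [p|p q|q p r /asboolP pq /asboolP qr]; last first.
- exact/asboolP/(qwitt_trans pq qr).
- by apply/asboolP/asboolP; apply: qwitt_sym.
- exact/asboolP/qisom_qwitt/qisom_refl.
Qed.
Canonical qwitt_equiv := EquivRelPack qwitt_equiv_subproof.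

Lemma bwitt_equiv_subproof : equiv_class_of (fun B C => `[< bwitt B C >]).
Proof.
split=> [B|B C|C B D /asboolP BC /asboolP CD]; last first.
- exact/asboolP/(bwitt_trans BC CD).
- by apply/asboolP/asboolP; apply: bwitt_sym.
- exact/asboolP/bwitt_refl.
Qed.
Canonical bwitt_equiv := EquivRelPack bwitt_equiv_subproof.
End WittGroups.

Definition Wq (F : fieldType) := {eq_quot (qwitt_equiv F)}.
HB.instance Definition _ F := Choice.on (Wq F).
HB.instance Definition _ F := EqQuotient.on (Wq F).

(* Only the set of classes of the Witt ring W(F) and its action on W_q(F) are
   set up. *)
Definition Wb (F : fieldType) := {eq_quot (bwitt_equiv F)}.
HB.instance Definition _ F := Choice.on (Wb F).
HB.instance Definition _ F := EqQuotient.on (Wb F).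

Section WittClasses.
Variable F : fieldType.
Implicit Types (p q r : qform F) (B C : bform F) (u v w : Wq F).

Definition qclass q : Wq F := \pi q.
Definition bclass B : Wb F := \pi B.

Lemma qclassP p q : qclass p = qclass q <-> qwitt p q.
Proof. by split=> [/eqmodP/asboolP//|pq]; apply/eqmodP/asboolP. Qed.

Lemma bclassP B C : bclass B = bclass C <-> bwitt B C.
Proof. by split=> [/eqmodP/asboolP//|BC]; apply/eqmodP/asboolP. Qed.

Lemma qclass_repr w : qclass (repr w) = w.
Proof. exact: reprK. Qed.

Lemma bclass_repr (b : Wb F) : bclass (repr b) = b.
Proof. exact: reprK. Qed.

Lemma qwitt_repr q : qwitt (repr (qclass q)) q.
Proof. exact/qclassP/qclass_repr. Qed.

Lemma bwitt_repr B : bwitt (repr (bclass B)) B.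
Proof. exact/bclassP/bclass_repr. Qed.

Definition Wq_add u v : Wq F := qclass (qsum (repr u) (repr v)).
Definition Wq_opp u : Wq F := qclass (qopp (repr u)).
Definition Wq_zero : Wq F := qclass (qhyp F 0).

Lemma Wq_addE p q : Wq_add (qclass p) (qclass q) = qclass (qsum p q).
Proof. by apply/qclassP/qwitt_sum; apply: qwitt_repr. Qed.

Lemma Wq_oppE q : Wq_opp (qclass q) = qclass (qopp q).
Proof. exact/qclassP/qwitt_opp/qwitt_repr. Qed.

Lemma qclass_hyp k : qclass (qhyp F k) = Wq_zero.
Proof.
apply/qclassP; exists 0, k; apply: qisom_trans (hypD _ _ _) _; rewrite addn0.
exact/qisom_sym/bisom_qisom/osum0.
Qed.

Lemma Wq_addA : associative Wq_add.
Proof.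
move=> u v w; rewrite -[u]qclass_repr -[v]qclass_repr -[w]qclass_repr !Wq_addE.
exact/qclassP/qisom_qwitt/qosumA.
Qed.

Lemma Wq_addC : commutative Wq_add.
Proof.
move=> u v; rewrite -[u]qclass_repr -[v]qclass_repr !Wq_addE.
exact/qclassP/qwitt_sumC.
Qed.

Lemma Wq_add0 : left_id Wq_zero Wq_add.
Proof.
move=> u; rewrite -[u]qclass_repr Wq_addE.
exact/qclassP/qisom_qwitt/bisom_qisom/osum0.
Qed.

Lemma Wq_addN : left_inverse Wq_zero Wq_opp Wq_add.
Proof.
move=> u; rewrite -[u]qclass_repr Wq_oppE Wq_addE -(qclass_hyp (qdim (repr u))).
by apply/qclassP/qisom_qwitt/osumN_hyp/(@qformP F (repr u)).
Qed.

HB.instance Definition _ :=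
  GRing.isZmodule.Build (Wq F) Wq_addA Wq_addC Wq_add0 Wq_addN.

Lemma qclassD p q : qclass p + qclass q = qclass (qsum p q).
Proof. exact: Wq_addE. Qed.

Lemma qclassN q : - qclass q = qclass (qopp q).
Proof. exact: Wq_oppE. Qed.

Definition Wq_tens (beta : Wb F) w : Wq F := qclass (qtens (repr beta) (repr w)).

Lemma Wq_tensE B q : Wq_tens (bclass B) (qclass q) = qclass (qtens B q).
Proof.
apply/qclassP/(qwitt_trans (qwitt_tensr _ (qwitt_repr q))).
exact/qwitt_tensl/bwitt_repr.
Qed.

Lemma Wq_tens_is_additive beta : zmod_morphism (Wq_tens beta).
Proof.
have tensD u v : Wq_tens beta (u + v) = Wq_tens beta u + Wq_tens beta v.
  rewrite -[beta]bclass_repr -[u]qclass_repr -[v]qclass_repr.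
  rewrite qclassD !Wq_tensE qclassD.
  exact/qclassP/qisom_qwitt/bisom_qisom/tens_osumr.
by move=> u v; apply: (addIr (Wq_tens beta v)); rewrite -tensD !subrK.
Qed.
HB.instance Definition _ beta :=
  GRing.isZmodMorphism.Build (Wq F) (Wq F) (Wq_tens beta) (Wq_tens_is_additive beta).
End WittClasses.

Notation "beta ⊗ w" := (Wq_tens beta w)
  (at level 40, left associativity) : ring_scope.

Section ScalarExtension.
Variables (F E : fieldType) (f : {rmorphism F -> E}).

Definition qmap (q : qform F) : qform E := QForm (@map_qnonsingular F E f _ q (@qformP F q)).

Lemma qwitt_map p q : qwitt p q -> qwitt (qmap p) (qmap q).
Proof.
case=> i [j e]; exists i, j.
by rewrite -!(map_hyp f) -!map_osum; apply: map_qisom.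
Qed.

Definition Wq_map (w : Wq F) : Wq E := qclass (qmap (repr w)).

Lemma Wq_mapE q : Wq_map (qclass q) = qclass (qmap q).
Proof. exact/qclassP/qwitt_map/qwitt_repr. Qed.

Lemma Wq_map_is_additive : zmod_morphism Wq_map.
Proof.
have mapD u v : Wq_map (u + v) = Wq_map u + Wq_map v.
  rewrite -[u]qclass_repr -[v]qclass_repr qclassD !Wq_mapE qclassD.
  by apply/qclassP/qisom_qwitt; rewrite /= map_osum; apply: qisom_refl.
by move=> u v; apply: (addIr (Wq_map v)); rewrite -mapD !subrK.
Qed.
HB.instance Definition _ :=
  GRing.isZmodMorphism.Build (Wq F) (Wq E) Wq_map Wq_map_is_additive.

Definition Wq_ker : set (Wq F) := [set w | Wq_map w = 0]%classic.
End ScalarExtension.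

Section Sumset.
Variable V : zmodType.
Implicit Types A B C : set V.
Local Open Scope classical_set_scope.

Definition sumset A B : set V := [set x + y | x in A & y in B].

Lemma sumsetA : associative sumset.
Proof.
move=> A B C; apply/seteqP; split=> z /=.
  case=> x Ax [_ [y By [t Ct <-]] <-]; exists (x + y); first by exists x => //; exists y.
  by exists t => //; rewrite addrA.
case=> _ [x Ax [y By <-]] [t Ct <-]; exists x => //; exists (y + t).
  by exists y => //; exists t.
by rewrite addrA.
Qed.

Lemma sumsetC : commutative sumset.
Proof.
by move=> A B; apply/seteqP; split=> _ [x Ax [y By <-]];
  exists y => //; exists x => //; rewrite addrC.
Qed.

Lemma sumset0 : left_id [set 0] sumset.
Proof.
move=> A; apply/seteqP; split=> [_ [_ -> [x Ax <-]]|x Ax]; first by rewrite add0r.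
by exists 0 => //; exists x; rewrite ?add0r.
Qed.

HB.instance Definition _ :=
  Monoid.isComLaw.Build (set V) [set 0] sumset sumsetA sumsetC sumset0.
End Sumset.

Lemma pfister_entries (F : fieldType) (a : F) :
  a != 0 -> all (fun c => c != 0) [:: 1; a].
Proof. by move=> a0; rewrite /= oner_neq0 a0. Qed.

(* <1, a>_b *)
Definition bpfister (F : fieldType) (a : F) (a0 : a != 0) : Wb F :=
  bclass (diagb (pfister_entries a0)).

(* Main.v *)
(* For a nonsingular form over F that becomes hyperbolic over an extension, write
   it as the orthogonal sum of the [al_i, be_i].  After exchanging al_i and be_i
   for some i, the Lagrangian over the extension is the graph of a symmetric
   matrix S, which means al_i = S_ii + sum_j be_j S_ij^2.

   Over K the squares S_ij^2 lie in F, hence so does S_ii.  The symbol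
   [x, y] is biadditive in W_q(F) and [s + y s^2, y] = 0, so the class of the form is
   the sum over i < j of [be_j c, be_i] + [be_i c, be_j] with c = S_ij^2.
   Such a sum lies in the sum of the <1, a_i> W_q(F): the c with this property
   form an additive group that contains the squares and is stable under
   multiplication by each a_i, hence it contains all the squares of K.

   Over L = K(t), write S_ij = u_ij + v_ij t with u_ij, v_ij in K.  The u_ij are
   handled as before and leave the classes [b v_ii, be_i], where
   v_ii = sum_j be_j v_ij^2.  Eliminating with pivots v_pp <> 0 expresses their
   sum by the v_pp [1, b], modulo the sum of the <1, a_i> W_q(F). *)
Require Import Defs.
From HB Require Import structures.
From mathcomp Require Import all_boot all_order all_algebra all_field.
From mathcomp Require Import boolp classical_sets.
From mathcomp Require Import ring zify.
Set Implicit Arguments.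
Unset Strict Implicit.
Unset Printing Implicit Defensive.
Import GRing.Theory.
Local Open Scope ring_scope.
Local Open Scope classical_set_scope.

(** * Binary forms *)
Section Brackets.
Variables (F : fieldType) (F2 : 2%N \in [pchar F]).
Implicit Types (a c d x y z : F).
Local Notation br x y := (qclass (bracket F2 x y)).

Lemma bracket_row_ind (P : 'rV[F]_(1 + 1) -> Prop) :
  (forall x y : F, P (row_mx x%:M y%:M)) -> forall v, P v.
Proof.
by move=> Pxy v; rewrite -[v]hsubmxK [lsubmx v]mx11_scalar [rsubmx v]mx11_scalar.
Qed.

Lemma bracketC x y : br x y = br y x.
Proof.
apply/qclassP/qisom_qwitt; pose P : 'M[F]_(1 + 1) := block_mx 0 1%:M 1%:M 0.
have PP : P *m P = 1%:M.
  by rewrite mulmx_block !(mulmx0, mul0mx, addr0, add0r, mulmx1) -scalar_mx_block.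
apply: (qisom_mx PP PP); elim/bracket_row_ind=> u v.
rewrite mul_row_block !(mulmx0, mulmx1, addr0, add0r) !qf_bracket; ring.
Qed.

Lemma bracket_diag_isom a x y c d (M : 'M[F]_(1 + 1)) : c != 0 -> d != 0 ->
  (forall u v, a * qf (bracket_mx x y) (row_mx (u * c)%:M (v * d)%:M) =
     qf M (row_mx u%:M v%:M)) ->
  qisom M (a *: bracket_mx x y).
Proof.
move=> c0 d0 qM.
pose D (c d : F) : 'M[F]_(1 + 1) := block_mx c%:M 0 0 d%:M.
have DD e g : e != 0 -> g != 0 -> D e g *m D e^-1 g^-1 = 1%:M.
  move=> e0 g0; rewrite mulmx_block -!scalar_mxM !mulfV //.
  by rewrite !(mulmx0, mul0mx, addr0, add0r) -scalar_mx_block.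
apply: (@qisom_mx _ _ _ _ _ (D c d) (D c^-1 d^-1)).
- exact: DD.
- by rewrite -[X in _ *m D X _]invrK -[X in _ *m D _ X]invrK DD ?invr_eq0.
elim/bracket_row_ind=> u v; rewrite -qM mul_row_block !(mulmx0, addr0, add0r).
by rewrite -!scalar_mxM /qf -scalemxAr -scalemxAl mxE.
Qed.

(** Dividing the second coordinate by [a] absorbs the scalar. *)
Lemma bracket_scale a x y : a != 0 ->
  qisom (a *: bracket_mx x (a * y)) (bracket_mx (a * x) y).
Proof.
move=> a0; apply/qisom_sym/(@bracket_diag_isom _ _ _ 1 a^-1); rewrite ?oner_neq0 ?invr_eq0 //.
by move=> u v; rewrite !qf_bracket; field.
Qed.

(** In a nonsingular plane an isotropic line is already a Lagrangian. *)
Lemma bracket0_of_root x y u v : (u != 0) || (v != 0) ->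
  x * u ^+ 2 + u * v + y * v ^+ 2 = 0 -> br x y = 0.
Proof.
move=> uv0 xy0; apply: etrans (qclass_hyp F 1); apply/qclassP/qisom_qwitt.
apply: (@lagrangian_hyp _ 1 _ _ (row_mx u%:M v%:M)).
- exact: bracket_nonsingular.
- by [].
- rewrite /row_free eqn_leq rank_leq_row lt0n mxrank_eq0 row_mx_eq0.
  have s0 (c : F) : (c%:M == 0 :> 'M_1) = (c == 0).
    by apply/eqP/eqP=> [/matrixP/(_ 0 0)|->]; rewrite ?raddf0 // !mxE.
  by rewrite !s0 negb_and.
- move=> z; rewrite [z]mx11_scalar mul_mx_row -!scalar_mxM qf_bracket.
  by rewrite -[RHS](mulr0 (z 0 0 ^+ 2)) -xy0; ring.
Qed.

Lemma bracket0l y : br 0 y = 0.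
Proof. by apply: (@bracket0_of_root _ _ 1 0); rewrite ?oner_neq0 //; ring. Qed.

Lemma bracket0r x : br x 0 = 0.
Proof. by rewrite bracketC bracket0l. Qed.

Lemma addFF (x : F) : x + x = 0.
Proof. exact: addrr_pchar2. Qed.

(** The vector (1, x) is isotropic. *)
Lemma bracket_artin_schreier x y : br (x + y * x ^+ 2) y = 0.
Proof.
apply: (@bracket0_of_root _ _ 1 x); rewrite ?oner_neq0 //.
(* Writing zero as a suitable doubled term brings characteristic 2 within reach of [ring]; the
   device recurs below. *)
by rewrite -[RHS](addFF (x + y * x ^+ 2)); ring.
Qed.

(** Scaling the coordinates by c and 1/c preserves the cross term; for c = 0 both symbols vanish. *)
Lemma bracket_sqr x y c : br (x * c ^+ 2) y = br x (c ^+ 2 * y).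
Proof.
have [->|c0] := eqVneq c 0; first by rewrite expr0n mulr0 mul0r bracket0l bracket0r.
apply/qclassP/qisom_qwitt; rewrite /= -[bracket_mx x _]scale1r.
apply: (@bracket_diag_isom _ _ _ c c^-1); rewrite ?invr_eq0 //.
by move=> u v; rewrite !qf_bracket; field.
Qed.

(** The substitution v -> v + v', u' -> u + u' is an isometry from [x + x', y] ⊥ [x', 0] to [x, y] ⊥
    [x', y], and [x', 0] is hyperbolic. *)
Lemma bracketDl x x' y : br (x + x') y = br x y + br x' y.
Proof.
rewrite qclassD; apply: (@etrans _ _ (br (x + x') y + br x' 0)).
  by rewrite bracket0r addr0.
rewrite qclassD; apply/qclassP/qisom_qwitt.
pose A : 'M[F]_(1 + 1) := block_mx 1%:M 0 0 0.
pose B : 'M[F]_(1 + 1) := block_mx 0 0 0 1%:M.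
pose P := block_mx 1%:M A B 1%:M.
have addMM m (X : 'M[F]_m) : X + X = 0 by apply/matrixP=> i j; rewrite !mxE addFF.
have PP : P *m P = 1%:M.
  rewrite mulmx_block !mulmx1 !mul1mx !addMM !mulmx_block.
  by rewrite !(mulmx0, mul0mx, addr0, add0r) block_mx0 ?addr0 ?add0r -scalar_mx_block.
apply: (qisom_mx PP PP) => z; rewrite -[z]hsubmxK.
move: (lsubmx z) (rsubmx z); elim/bracket_row_ind=> u v; elim/bracket_row_ind=> u' v'.
rewrite mul_row_block !mulmx1 !mul_row_block !(mulmx0, mul0mx, mulmx1, addr0, add0r).
rewrite !add_row_mx !(addr0, add0r) -!raddfD /= !qf_osum !qf_bracket.
apply/eqP; rewrite -subr_eq0; apply/eqP.
rewrite -[RHS](addFF (x' * u * u' + v * y * v' )).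
ring: (addFF 1).
Qed.

(** Since a[z, ax] is isometric to [az, x], working modulo multiples of <1, a>_b lets the factor a
    pass from one slot of the symbol to the other. *)
Lemma bpfister_bracket a (a0 : a != 0) x z :
  bpfister a0 ⊗ br z (a * x) = br (a * z) x + br z (a * x).
Proof.
rewrite Wq_tensE addrC qclassD; apply/qclassP/qisom_qwitt.
apply: qisom_trans (bisom_qisom (tens_diagb_cons _ _ _)) _.
apply: qisom_osum; first by rewrite scale1r; apply: qisom_refl.
apply: qisom_trans (bisom_qisom (tens_diagb_cons _ _ _)) _.
apply: qisom_trans (qosumC _ _) _.
by apply: qisom_trans (bisom_qisom (osum0 _ _)) _; apply: bracket_scale.
Qed.

(** With beta = <c>_b, the form c[b, 1] is [bc, 1/c]. Elimination with a pivot c splits off symbols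
    of this shape. *)
Lemma scaled_bracket_mem c b : c != 0 ->
  exists beta : Wb F, beta ⊗ br 1 b = br (b * c) c^-1.
Proof.
move=> c0; have s0 : all (fun a => a != 0) [:: c] by rewrite /= c0.
exists (bclass (diagb s0)); rewrite bracketC Wq_tensE; apply/qclassP/qisom_qwitt.
apply: qisom_trans (bisom_qisom (tens_diagb_cons _ _ _)) _.
apply: qisom_trans (qosumC _ _) _.
apply: qisom_trans (bisom_qisom (osum0 _ _)) _.
rewrite /= -[X in bracket_mx b X](mulfV c0) [b * c]mulrC; exact: bracket_scale.
Qed.

(** * Decomposition of nonsingular forms into binary forms *)

Lemma qclass_split k n (M : 'M[F]_n) (C : 'M[F]_(k, n)) :
  qnonsingular M -> C *m (M + M^T) *m C^T \in unitmx ->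
  exists m (N : 'M[F]_m), (k + m = n)%N /\ qisom (osum (C *m M *m C^T) N) M.
Proof.
move=> /qnonsingularP uG uC; set G := M + M^T in uG uC.
(* [K] spans the orthogonal complement of the row space of [C] for the polar form. *)
pose K := row_base (kermx (G *m C^T)).
have KC : K *m G *m C^T = 0.
  by rewrite -mulmxA; apply/sub_kermxP; rewrite eq_row_base.
have rGC : \rank (G *m C^T) = k.
  apply/eqP; rewrite eqn_leq rank_leq_col /=.
  by rewrite -{1}(mxrank_unit uC) -mulmxA mxrankM_maxr.
have dim : (k + \rank (kermx (G *m C^T)) = n)%N.
  by rewrite mxrank_ker rGC subnKC // -rGC rank_leq_row.
exists _, (K *m M *m K^T); split=> //.
pose P := col_mx C K.
have fP : row_full P.
  rewrite -sub1mx; apply/row_subP=> i; set x := row i _.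
  (* [y *m C] is the orthogonal projection of [x] to the row space of [C]; the remainder lies in the
     complement. *)
  pose y := x *m G *m C^T *m invmx (C *m G *m C^T).
  rewrite -[x](subrK (y *m C)) addmx_sub //; last first.
    by rewrite -addsmxE (submx_trans _ (addsmxSl _ _)) // submxMl.
  rewrite -addsmxE (submx_trans _ (addsmxSr _ _)) // eq_row_base.
  apply/sub_kermxP; rewrite mulmxBl.
  have -> : y *m C *m (G *m C^T) = y *m (C *m G *m C^T) by rewrite !mulmxA.
  by rewrite /y mulmxKV // mulmxA subrr.
have rP : row_free P by rewrite /row_free (eqP fP) dim.
have [Q PQ] := row_freeP rP; have [Q' QP] := row_fullP fP.
have eQ : Q' = Q by rewrite -[LHS]mulmx1 -PQ mulmxA QP mul1mx.
rewrite {}eQ in QP; apply: (qisom_mx PQ QP) => x.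
rewrite -[x]hsubmxK qf_osum mul_row_col.
have := qpolarE M (lsubmx x *m C) (rsubmx x *m K).
rewrite /qpolar -!qf_mul => /eqP; rewrite subr_eq => /eqP/esym/eqP.
rewrite eq_sym subr_eq => /eqP->.
suff -> : bf G (lsubmx x *m C) (rsubmx x *m K) = 0 by rewrite add0r addrC.
rewrite /bf trmx_mul !mulmxA -[_ *m K^T]trmxK trmx_mul trmxK.
have -> : (lsubmx x *m C *m G)^T = G *m C^T *m (lsubmx x)^T.
  by rewrite !trmx_mul /G linearD /= trmxK (addrC M^T) mulmxA.
by rewrite !mulmxA KC mul0mx trmx0 mul0mx mxE.
Qed.

(** All first coordinates precede all second ones, so that a half-dimensional subspace is the row
    space of [row_mx A B] with square blocks. *)
Definition bracket_sum_mx (L : fieldType) m (al be : 'rV[L]_m) : 'M[L]_(m + m) :=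
  block_mx (diag_mx al) 1%:M 0 (diag_mx be).

Lemma qf_bracket_sum (L : fieldType) m (al be x y : 'rV[L]_m) :
  qf (bracket_sum_mx al be) (row_mx x y) =
  \sum_i (al 0 i * x 0 i ^+ 2 + x 0 i * y 0 i + be 0 i * y 0 i ^+ 2).
Proof.
rewrite /qf mul_row_block tr_row_mx mul_row_col mulmx0 addr0 mulmx1 mulmxDl.
rewrite !mul_mx_diag !mxE -!big_split /=; apply: eq_bigr => i _.
by rewrite !mxE; ring.
Qed.

Lemma bracket_sum_mxD m k (al be : 'rV[F]_m) (al' be' : 'rV[F]_k) :
  qisom (osum (bracket_sum_mx al be) (bracket_sum_mx al' be'))
        (bracket_sum_mx (row_mx al al') (row_mx be be')).
Proof.
pose P : 'M[F]_((m + m) + (k + k), (m + k) + (m + k)) :=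
  block_mx (block_mx 1%:M 0 0 0) (block_mx 0 0 1%:M 0)
           (block_mx 0 1%:M 0 0) (block_mx 0 0 0 1%:M).
pose Q : 'M[F]_((m + k) + (m + k), (m + m) + (k + k)) :=
  block_mx (block_mx 1%:M 0 0 0) (block_mx 0 0 1%:M 0)
           (block_mx 0 1%:M 0 0) (block_mx 0 0 0 1%:M).
apply: (@qisom_mx _ _ _ _ _ P Q) => [||x].
- rewrite /P /Q !mulmx_block !(mulmx0, mul0mx, mulmx1, addr0, add0r).
  rewrite !add_block_mx !(addr0, add0r).
  by rewrite -!scalar_mx_block !block_mx0 -scalar_mx_block.
- rewrite /P /Q !mulmx_block !(mulmx0, mul0mx, mulmx1, addr0, add0r).
  rewrite !add_block_mx !(addr0, add0r).
  by rewrite -!scalar_mx_block !block_mx0 -scalar_mx_block.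
rewrite -[x]hsubmxK -[lsubmx x]hsubmxK -[rsubmx x]hsubmxK.
move: (lsubmx (lsubmx x)) (rsubmx (lsubmx x)) (lsubmx (rsubmx x)) (rsubmx (rsubmx x)).
move=> x1 y1 x2 y2; rewrite mul_row_block !mul_row_block.
rewrite !(mulmx0, mul0mx, mulmx1, addr0, add0r) !add_row_mx !(addr0, add0r).
rewrite qf_osum !qf_bracket_sum big_split_ord /=.
by congr (_ + _); apply: eq_bigr => i _; rewrite !(row_mxEl, row_mxEr).
Qed.

Lemma bracket_sum_mx1 (a b : F) : bracket_sum_mx a%:M b%:M = bracket_mx a b.
Proof.
rewrite /bracket_sum_mx /bracket_mx; congr block_mx;
  by apply/matrixP=> i j; rewrite !ord1 !mxE.
Qed.

Lemma qnonsingular_osumr m n (M : 'M[F]_m) (N : 'M[F]_n) :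
  qnonsingular (osum M N) -> qnonsingular N.
Proof.
move=> ns x Nx; suff /eq_row_mx[] : row_mx 0 x = row_mx (0 : 'rV_m) 0 by [].
rewrite row_mx0; apply: ns => y; rewrite -[y]hsubmxK -[RHS](Nx (rsubmx y)).
by rewrite /qpolar add_row_mx add0r !qf_osum {3}/qf !mul0mx mxE; ring.
Qed.

Lemma qpolarxx n (M : 'M[F]_n) v : qpolar M v v = 0.
Proof.
have addv : v + v = 0 by apply/rowP=> i; rewrite !mxE addFF.
rewrite /qpolar addv {1}/qf !mul0mx mxE add0r.
by apply: oppr_inj; rewrite opprB opprK addFF oppr0.
Qed.

Lemma mulmx_bf n (B : 'M[F]_n) (x y : 'rV[F]_n) : x *m B *m y^T = (bf B x y)%:M.
Proof. by rewrite [LHS]mx11_scalar. Qed.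

(** A nonzero e pairs nontrivially with some vector, which scales to f with polar value 1. Then e
    and f span the plane [q(e), q(f)], which splits off. *)
Lemma qform_plane_split (q : qform F) : (0 < qdim q)%N ->
  exists a b (r : qform F), (2 + qdim r = qdim q)%N /\ qisom (qsum (bracket F2 a b) r) q.
Proof.
case: q => [[|n] M nsM] // _; set G := M + M^T.
pose e : 'rV[F]_n.+1 := delta_mx 0 0.
have [g eg] : exists g, bf G e g != 0.
  apply: contrapT => /forallNP eG; have : e = 0.
    apply: nsM => y; rewrite qpolarE; apply/eqP; apply: contrapT => /negP.
    exact: eG.
  by move/matrixP/(_ 0 0)/eqP; rewrite !mxE eqxx oner_eq0.
pose f := (bf G e g)^-1 *: g.
have ef : bf G e f = 1 by rewrite /bf linearZ /= -scalemxAr mxE mulVf.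
pose C := col_mx e f.
have GC : C *m G *m C^T = block_mx 0 1%:M 1%:M 0.
  rewrite mul_col_mx tr_col_mx mul_col_row !mulmx_bf -!qpolarE !qpolarxx raddf0.
  have -> : qpolar M f e = qpolar M e f by rewrite /qpolar (addrC f) addrAC.
  by rewrite qpolarE ef.
have uC : C *m G *m C^T \in unitmx.
  rewrite GC; set H := block_mx _ _ _ _; have [] // := @mulmx1_unit _ _ H H.
  by rewrite mulmx_block !(mulmx0, mul0mx, addr0, add0r, mulmx1) -scalar_mx_block.
have [m [N [dim iso]]] := qclass_split nsM uC.
have nsN := qnonsingular_osumr (qnonsingular_isom (qisom_sym iso) nsM).
exists (qf M e), (qf M f), (QForm nsN); split=> //.
apply: qisom_trans iso; apply: qisom_osum (qisom_refl _); apply: qisom_eq.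
elim/bracket_row_ind=> u v; rewrite -qf_mul qf_bracket mul_row_col !mul_scalar_mx.
have efZ : bf G (u *: e) (v *: f) = u * v.
  rewrite /bf [(v *: f)^T]linearZ /= -scalemxAr -!scalemxAl !scalerA mxE mulmx_bf.
  by rewrite ef !mxE mulr1 mulrC.
have qZ c w : qf M (c *: w) = qf M w * c ^+ 2.
  by rewrite /qf [(c *: w)^T]linearZ /= -scalemxAr -!scalemxAl scalerA mxE mulrC expr2.
have := qpolarE M (u *: e) (v *: f); rewrite efZ /qpolar !qZ => /eqP.
by rewrite !subr_eq => /eqP->; ring.
Qed.

(** The isometry is what scalar extension transports; the equation of classes feeds the calculus of
    symbols. *)
Lemma qform_bracket_sum (q : qform F) :
  exists m (al be : 'rV[F]_m), qisom q (bracket_sum_mx al be) /\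
    qclass q = \sum_i br (al 0 i) (be 0 i).
Proof.
have [n] := ubnP (qdim q); elim: n q => // n IHn q /ltnSE le_q.
have [q0|] := posnP (qdim q).
  exists 0, 0, 0; have iso : qisom q (bracket_sum_mx 0 0 : 'M[F]_(0 + 0)).
    case: q q0 {le_q} => d M /= nsM d0; move: d0 M nsM => -> M nsM.
    by rewrite [M]thinmx0 [bracket_sum_mx _ _]thinmx0; apply: qisom_refl.
  split=> //; rewrite big_ord0; apply: etrans (qclass_hyp F 0).
  apply/qclassP/qisom_qwitt/(qisom_trans iso).
  by rewrite [bracket_sum_mx _ _]thinmx0 [X in qisom _ X]thinmx0; apply: qisom_refl.
case/qform_plane_split=> a [b [r [dim /qisom_sym iso]]].
have [|m [al [be [isor cr]]]] := IHn r.
  by rewrite -dim in le_q; apply: leq_trans le_q; rewrite ltnS leqnSn.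
exists (1 + m)%N, (row_mx a%:M al), (row_mx b%:M be); split.
  apply: qisom_trans iso (qisom_trans _ (bracket_sum_mxD _ _ _ _)).
  by rewrite bracket_sum_mx1; apply: qisom_osum isor; apply: qisom_refl.
move/qisom_qwitt/qclassP: iso => ->; rewrite -qclassD cr big_split_ord /= big_ord1.
rewrite !row_mxEl !mxE; congr (_ + _).
by apply: eq_bigr => i _; rewrite !row_mxEr.
Qed.
End Brackets.

(** * Forms hyperbolic over an extension *)
Section HyperbolicOver.
Variables (F : fieldType) (F2 : 2%N \in [pchar F]).
Local Notation br x y := (qclass (bracket F2 x y)).
Variables (L : fieldType) (f : {rmorphism F -> L}).

(* Induction on the corank of A: if x A = 0 and (x B)_j != 0, then exchanging the
   j-th columns of A and B increases the rank, because A B^T is symmetric. *)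
Lemma lagrangian_chart m (al be : 'rV[F]_m) (A B : 'M[L]_m) :
  row_free (row_mx A B) ->
  (forall x, qf (bracket_sum_mx (map_mx f al) (map_mx f be)) (x *m row_mx A B) = 0) ->
  exists (al' be' : 'rV[F]_m) (S : 'M[L]_m), [/\ S^T = S,
    forall i, f (al' 0 i) = S i i + \sum_j f (be' 0 j) * S i j ^+ 2
    & \sum_i br (al 0 i) (be 0 i) = \sum_i br (al' 0 i) (be' 0 i)].
Proof.
have L2 : 2%N \in [pchar L] by apply: rmorph_pchar F2.
have [k] := ubnP (m - \rank A)%N; elim: k => // k IHk in al be A B *.
move=> /ltnSE lek fAB qAB; set D := bracket_sum_mx _ _ in qAB.
pose T := A *m diag_mx (map_mx f al) *m A^T + A *m B^T + B *m diag_mx (map_mx f be) *m B^T.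
have /qf0P[T_sym T_diag] : forall x, qf T x = 0.
  move=> x; rewrite -(qAB x) qf_mul; congr (qf _ x).
  rewrite /D mul_row_block tr_row_mx mul_row_col mulmx0 addr0 mulmx1 mulmxDl.
  by rewrite addrA.
(* The diagonal terms of [T] are symmetric, so the difference of the two sides is T - T^T, which is
   2T = 0 because [T] is alternating. *)
have AB_sym : A *m B^T = B *m A^T.
  apply/eqP; rewrite -subr_eq0; apply/eqP; transitivity (T - T^T).
    have symD (U : 'M[L]_m) d : (U *m diag_mx d *m U^T)^T = U *m diag_mx d *m U^T.
      by rewrite !trmx_mul trmxK tr_diag_mx mulmxA.
    rewrite /T [(_ + _)^T]linearD /= [(_ + A *m B^T)^T]linearD /= !symD trmx_mul trmxK.
    by rewrite opprD addrACA subrr addr0 opprD addrACA subrr add0r.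
  by rewrite T_sym opprK; apply/matrixP=> i j; rewrite !mxE addrr_pchar2.
(* If [A] is invertible, the Lagrangian is the graph of A^-1 B, and isotropy of the i-th row of (1,
   S) is the i-th equation. *)
have [uA|] := boolP (A \in unitmx).
  pose S := invmx A *m B.
  have S_sym : S^T = S.
    rewrite /S trmx_mul; apply: (can_inj (mulKmx uA)).
    rewrite mulKVmx // mulmxA AB_sym trmx_inv -mulmxA mulmxV ?mulmx1 //.
    by rewrite unitmx_tr.
  exists al, be, S; split=> // i.
  have := qAB (delta_mx 0 i *m invmx A).
  rewrite -mulmxA mul_mx_row mulVmx // -/S mul_mx_row mulmx1 qf_bracket_sum -rowE.
  rewrite !big_split /= (bigD1 i) //= [X in _ + X + _](bigD1 i) //=.
  rewrite big1 => [|j ji]; last by rewrite !mxE eqxx (negPf ji) /= expr0n mulr0.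
  rewrite [X in _ + (_ + X) + _]big1 => [|j ji]; last by rewrite !mxE eqxx (negPf ji) mul0r.
  rewrite !mxE !eqxx expr1n mulr1 mul1r !addr0 -addrA => /eqP.
  rewrite addr_eq0 => /eqP ->; rewrite oppr_pchar2 //; congr (_ + _).
  by apply: eq_bigr => j _; rewrite !mxE.
rewrite -row_free_unit -kermx_eq0 => /rowV0Pn[x /sub_kermxP xA x0].
have [j xBj] : exists j, (x *m B) 0 j != 0.
  apply: contrapT => /forallNP xB; move/eqP: x0; apply; apply/eqP.
  rewrite -(mulmx_free_eq0 _ fAB) mul_mx_row xA row_mx_eq0 eqxx /=.
  by apply/eqP/rowP=> j; rewrite [RHS]mxE; apply/eqP; apply: contrapT => /negP; apply: xB.
pose sw (U V : 'M[L]_m) := \matrix_(r, c) (if c == j then V else U) r c.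
have swE (U V : 'M[L]_m) (y : 'rV_m) c :
    (y *m sw U V) 0 c = (if c == j then y *m V else y *m U) 0 c.
  by case: ifP => cj; rewrite !mxE; apply: eq_bigr => i _; rewrite !mxE cj.
pose swr (u v : 'rV[F]_m) := \row_c (if c == j then v else u) 0 c.
have swr_sum : \sum_i br (al 0 i) (be 0 i) = \sum_i br (swr al be 0 i) (swr be al 0 i).
  by apply: eq_bigr => i _; rewrite !mxE; case: ifP => // _; apply: bracketC.
(* Only the j-th entry of yA can survive; its product with (xB)_j is y A B^T x^T = y B A^T x^T = 0,
   since xA = 0. *)
have swK (y : 'rV_m) : y *m sw A B = 0 -> y *m A = 0.
  move=> yA'; have yA i : i != j -> (y *m A) 0 i = 0.
    by move=> ij; have := swE A B y i; rewrite yA' (negPf ij) !mxE.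
  have : (y *m A *m (x *m B)^T) 0 0 = 0.
    rewrite trmx_mul -!mulmxA (mulmxA A) AB_sym -!mulmxA -trmx_mul xA trmx0.
    by rewrite !mulmx0 mxE.
  rewrite mxE (bigD1 j) //= big1 => [|i ij]; last by rewrite yA ?mul0r.
  rewrite addr0 [_^T _ _]mxE => /eqP; rewrite mulf_eq0 (negPf xBj) orbF => /eqP yAj.
  apply/rowP=> i; rewrite [RHS]mxE; have [->|ij] := eqVneq i j; [exact: yAj|exact: yA].
(* The kernel shrinks strictly: it loses [x], whose new j-th entry is (xB)_j. *)
have rank_lt : (\rank A < \rank (sw A B))%N.
  have : (kermx (sw A B) < kermx A)%MS.
    rewrite ltmxE; apply/andP; split.
      by apply/rV_subP=> y /sub_kermxP /swK yA; apply/sub_kermxP.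
    apply/negP=> sub; have /(submx_trans)/(_ sub)/sub_kermxP xA' : (x <= kermx A)%MS.
      by apply/sub_kermxP.
    by have := swE A B x j; rewrite xA' eqxx mxE => /esym/eqP; apply/negP.
  move/rank_ltmx; rewrite !mxrank_ker; have := rank_leq_row A.
  have := rank_leq_row (sw A B); lia.
have [|||al' [be' [S [S1 S2 S3]]]] := IHk (swr al be) (swr be al) (sw A B) (sw B A).
- by move: lek rank_lt (rank_leq_row (sw A B)); lia.
- apply: inj_row_free => y; rewrite mul_mx_row => /eqP; rewrite row_mx_eq0.
  case/andP=> /eqP yA' /eqP yB'; apply/eqP.
  rewrite -(mulmx_free_eq0 _ fAB) mul_mx_row (swK _ yA') row_mx_eq0 eqxx /=.
  apply/eqP/rowP=> i; have := swE A B y i; have := swE B A y i.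
  by rewrite yA' yB'; case: ifP => _ e1 e2.
- move=> y; rewrite -[RHS](qAB y) !mul_mx_row !qf_bracket_sum.
  apply: eq_bigr => i _; rewrite !swE ![map_mx _ _ 0 i]mxE ![swr _ _ 0 i]mxE.
  by case: ifP => _; ring.
by exists al', be', S; split=> //; rewrite swr_sum.
Qed.

Lemma Wq_map_eq0 w : Wq_map f w = 0 ->
  exists m (al be : 'rV[F]_m) (S : 'M[L]_m), [/\ S^T = S,
    forall i, f (al 0 i) = S i i + \sum_j f (be 0 j) * S i j ^+ 2
    & w = \sum_i br (al 0 i) (be 0 i)].
Proof.
rewrite -[w]qclass_repr; move: (repr w) => {w} q.
rewrite Wq_mapE => /qclassP[i [j iso]].
(* The i planes that make the extended form hyperbolic are put into the form itself, at no cost for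
   its class. *)
have -> : qclass q = qclass (qsum q (qhyp F i)) by rewrite -qclassD qclass_hyp addr0.
have [m [al [be [isoq ->]]]] := qform_bracket_sum F2 (qsum q (qhyp F i)).
have /qisomP[P [Q [PQ QP qP]]] :
    qisom (hyp L j) (bracket_sum_mx (map_mx f al) (map_mx f be)).
  have := map_qisom f isoq; rewrite map_osum map_hyp.
  rewrite /bracket_sum_mx map_block_mx !map_diag_mx map_mx0 map_mx1 => isoL.
  apply: qisom_trans isoL; apply: qisom_trans (qisom_sym iso).
  exact/qisom_sym/(hypD L 0 j).
have ejm : j = m.
  by have := mulmx1_min PQ; have := mulmx1_min QP; lia.
(* The rows of [R] are the images of a standard Lagrangian of the hyperbolic form. *)
subst j; pose R := row_mx 1%:M 0 *m P : 'M_(m, m + m).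
have RE : R = row_mx (lsubmx R) (rsubmx R) by rewrite hsubmxK.
have [||al' [be' [S [S1 S2 S3]]]] := @lagrangian_chart m al be (lsubmx R) (rsubmx R).
- rewrite -RE; apply/row_freeP; exists (Q *m col_mx 1%:M 0).
  by rewrite /R mulmxA -(mulmxA _ P) PQ mulmx1 mul_row_col mulmx1 mulmx0 addr0.
- move=> x; rewrite -RE /R mulmxA qP mul_mx_row mulmx1 mulmx0.
  by rewrite /qf /hyp mul_row_block tr_row_mx mul_row_col !(mulmx0, mul0mx, addr0, trmx0) mxE.
by exists m, al', be', S.
Qed.
End HyperbolicOver.

(** * Sums of binary forms in the Witt group *)
Section BracketSums.
Variables (F : fieldType) (F2 : 2%N \in [pchar F]).
Local Notation br x y := (qclass (bracket F2 x y)).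

Lemma bracketDr x y y' : br x (y + y') = br x y + br x y'.
Proof. by rewrite !(bracketC _ x) bracketDl. Qed.

Lemma bracketFF x y : br x y + br x y = 0.
Proof. by rewrite -bracketDl addrr_pchar2 // bracket0l. Qed.

Lemma bracket_suml I r (Q : pred I) (x : I -> F) y :
  br (\sum_(i <- r | Q i) x i) y = \sum_(i <- r | Q i) br (x i) y.
Proof. by apply: (big_morph (fun x => br x y)) => [? ?|]; rewrite ?bracketDl ?bracket0l. Qed.

Lemma bracket_sumr I r (Q : pred I) x (y : I -> F) :
  br x (\sum_(i <- r | Q i) y i) = \sum_(i <- r | Q i) br x (y i).
Proof. by rewrite bracketC bracket_suml; apply: eq_bigr => i _; apply: bracketC. Qed.

(** In the application [T] consists of the squares of elements of K and [P] is the sum of the <1,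
    a_i>_b W_q(F). *)
Variables (T : F -> Prop) (P : Wq F -> Prop).
Hypothesis T_D : forall c d, T c -> T d -> T (c + d).
Hypothesis T_M : forall c d, T c -> T d -> T (c * d).
Hypothesis T_sqr : forall c, T (c ^+ 2).
Hypothesis P0 : P 0.
Hypothesis P_D : forall u v, P u -> P v -> P (u + v).
Hypothesis P_swap : forall c x y, T c -> P (br (x * c) y + br x (c * y)).

Lemma sum_closed I r (Q : pred I) (w : I -> Wq F) :
  (forall i, Q i -> P (w i)) -> P (\sum_(i <- r | Q i) w i).
Proof. by move=> Pw; elim/big_ind: _. Qed.

(** The terms at (i, j) and (j, i) together form one instance of [P_swap]. *)
Lemma symmetric_sum_mem m (be : 'I_m -> F) (N : 'I_m -> 'I_m -> F) :
  (forall i j, N i j = N j i) -> (forall i j, T (N i j)) ->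
  P (\sum_i \sum_(j | j != i) br (be j * N i j) (be i)).
Proof.
move=> N_sym TN; set G := fun i j => br (be j * N i j) (be i).
have -> : \sum_i \sum_(j | j != i) G i j = \sum_(i < m) \sum_(j < m | (i < j)%N) (G i j + G j i).
  under [RHS]eq_bigr do rewrite big_split /=.
  rewrite big_split /= [X in _ + X](exchange_big_dep predT) //= -big_split /=.
  apply: eq_bigr => i _; rewrite (bigID (fun j : 'I_m => (i < j)%N)) /=.
  by congr (_ + _); apply: eq_bigl => j; rewrite -val_eqE /=; lia.
do 2!apply: sum_closed => ? _; rewrite /G N_sym [X in _ + X]bracketC [be _ * _ in X in _ + X]mulrC.
exact: P_swap.
Qed.

(** The diagonal contributes s_i + be_i s_i^2, whose symbol with be_i vanishes; the symmetric
    off-diagonal sum remains. *)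
Lemma diagonal_sum_mem m (al be s : 'I_m -> F) (N : 'I_m -> 'I_m -> F) :
  (forall i j, N i j = N j i) -> (forall i j, T (N i j)) ->
  (forall i, N i i = s i ^+ 2) ->
  (forall i, al i = s i + \sum_j be j * N i j) ->
  P (\sum_i br (al i) (be i)).
Proof.
move=> N_sym TN Nii alE; have := symmetric_sum_mem be N_sym TN.
congr P; apply: eq_bigr => i _; symmetry.
rewrite alE (bigD1 i) //= Nii addrA bracketDl bracket_artin_schreier add0r.
by rewrite bracket_suml.
Qed.

(** [G] will be the sum of [P] and the set of the beta ⊗ [1, b]. *)
Variables (b : F) (G : Wq F -> Prop).
Hypothesis G_D : forall u v, G u -> G v -> G (u + v).
Hypothesis P_G : forall u, P u -> G u.
Hypothesis G_scaled : forall c, c != 0 -> G (br (b * c) c^-1).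

(* The pivot d p != 0 splits off the summand [b (d p), 1 / d p], and the Schur
   complement of N at p satisfies the same equations. *)
Lemma schur_sum_mem m (D : {set 'I_m}) (be d : 'I_m -> F) (N : 'I_m -> 'I_m -> F) :
  (forall i j, N i j = N j i) -> (forall i j, T (N i j)) ->
  (forall i, N i i = d i ^+ 2) ->
  (forall i, i \in D -> d i = \sum_(j in D) be j * N i j) ->
  G (\sum_(i in D) br (b * d i) (be i)).
Proof.
have charF (x : F) : x + x = 0 by apply: addrr_pchar2.
have [k] := ubnP #|D|; elim: k D d N => // k IHk D d N /ltnSE leD N_sym TN Nii dE.
have [/existsP[p /andP[pD dp0]]|/existsPn d0] := boolP [exists p, (p \in D) && (d p != 0)]; last first.
  apply/P_G/sum_closed => i iD; have := d0 i; rewrite iD /= negbK => /eqP ->.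
  by rewrite mulr0 bracket0l; apply: P0.
pose c j := N p j / d p ^+ 2.
have Tc j : T (c j) by apply: T_M => //; rewrite -exprVn; apply: T_sqr.
(* The pivot entry N_pp is d_p^2. In characteristic 2 the new diagonal entry d_i^2 + (N_pi / d_p)^2
   is again a square, that of d'_i. *)
pose d' j := d j + N p j / d p.
pose N' i j := N i j + N p i * c j.
(* This is the p-th equation divided by d_p^2. *)
have pE : (d p)^-1 = be p + \sum_(j in D :\ p) be j * c j.
  have := dE p pD; rewrite (big_setD1 p pD) /= Nii => dpE.
  rewrite {1}(_ : (d p)^-1 = d p / d p ^+ 2); last by field.
  rewrite {1}dpE mulrDl mulfK ?expf_neq0 // mulr_suml; congr (_ + _).
  by apply: eq_bigr => j _; rewrite mulrA.
(* Substitute be_p = 1/d_p + sum_j be_j c_j in the p-th term and d_j = d'_j + d_p c_j in the others;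
   the corrections pair up for [P_swap]. *)
have -> : \sum_(i in D) br (b * d i) (be i) =
    br (b * d p) (d p)^-1 + \sum_(j in D :\ p) br (b * d' j) (be j)
    + \sum_(j in D :\ p) (br (b * d p * c j) (be j) + br (b * d p) (c j * be j)).
  rewrite (big_setD1 p pD) /= pE bracketDr bracket_sumr -!addrA; congr (_ + _).
  rewrite -!big_split /=; apply: eq_bigr => j _.
  rewrite /d' mulrDr bracketDl.
  have -> : b * (N p j / d p) = b * d p * c j by rewrite /c; field.
  rewrite [c j * _]mulrC [RHS](_ : _ = br (b * d j) (be j)) //.
  set X := br (b * d p) _; set Y := br (b * d p * c j) _.
  have XX : X + X = 0 by apply: bracketFF.
  have YY : Y + Y = 0 by apply: bracketFF.
  by rewrite addrC -!addrA XX addr0 YY addr0.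
apply: (G_D (G_D (G_scaled dp0) _)); last first.
  by apply/P_G/sum_closed => j _; apply: P_swap.
apply: (IHk _ d' N').
- by rewrite (cardsD1 p D) pD in leD.
- by move=> i j; rewrite /N' N_sym /c; field.
- by move=> i j; apply: T_D => //; apply: T_M.
- move=> i; rewrite /N' Nii /d' /c; apply/eqP; rewrite -subr_eq0; apply/eqP.
  rewrite -[RHS](charF (- d i * (N p i / d p))); field.
  exact: dp0.
- move=> i /setD1P[ip iD].
  rewrite /N'; under eq_bigr do rewrite mulrDr [N p i * _]mulrC mulrA.
  rewrite big_split /= -mulr_suml.
  have -> : \sum_(j in D :\ p) be j * N i j = d i - be p * N p i.
    by rewrite (dE i iD) (big_setD1 p pD) /= N_sym addrC addrK.
  have -> : \sum_(j in D :\ p) be j * c j = (d p)^-1 - be p.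
    by rewrite pE addrAC subrr add0r.
  rewrite /d'; apply/eqP; rewrite -subr_eq0; apply/eqP.
  rewrite -[RHS](charF (be p * N p i)); ring.
Qed.
End BracketSums.

(** * Inclusion of the kernels *)
Section Subfields.
Variables (F : fieldType) (F2 : 2%N \in [pchar F]) (E : fieldExtType F).
Local Notation br x y := (qclass (bracket F2 x y)).
Implicit Types (K M : {subfield E}).

Lemma vsval_alg M c : vsval (c%:A : subvs_of M) = c%:A.
Proof. by rewrite linearZ /= algid1. Qed.

(** Moving the entries of S from the subfield to E lets computations over different subfields share
    one ambient field. *)
Lemma Wq_ker_subfield M w : Wq_ker (in_alg (subvs_of M)) w ->
  exists m (al be : 'I_m -> F) (S : 'I_m -> 'I_m -> E),
    [/\ forall i j, S i j \in M, forall i j, S i j = S j i,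
        forall i, (al i)%:A = S i i + \sum_j (be j)%:A * S i j ^+ 2
      & w = \sum_i br (al i) (be i)].
Proof.
case/(Wq_map_eq0 F2)=> m [al [be [S [S_sym alE ->]]]].
exists m, (al 0), (be 0), (fun i j => vsval (S i j)); split=> // [i j|i j|i].
- exact: subvsP.
- by rewrite -[in LHS]S_sym mxE.
apply: etrans (etrans (esym (vsval_alg M _)) (congr1 vsval (alE i))) _.
rewrite linearD linear_sum; congr (_ + _); apply: eq_bigr => j _.
by rewrite /= -(vsval_alg M (be 0 j)) expr2.
Qed.

(** Horner evaluation of a polynomial at z, with z^2 reduced at each stage. *)
Lemma adjoin_quadratic K x z : z ^+ 2 \in (K + K * <[z]>)%VS -> x \in <<K; z>>%VS ->
  exists u v, [/\ u \in K, v \in K & x = u + v * z].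
Proof.
case/memv_addP=> q Kq [_ /memv_cosetP[p Kp ->] zz] /Fadjoin_polyP[g Kg ->].
elim/poly_ind: g Kg => [|g c IHg] /polyOverP Kg.
  by exists 0, 0; rewrite horner0 mul0r addr0 mem0v.
have Kc : c \in K.
  by have := Kg 0; rewrite coefD coefMX coefC add0r.
have /IHg[u [v [Ku Kv gz]]] : g \is a polyOver K.
  apply/polyOverP=> i; have := Kg i.+1.
  by rewrite coefD coefMX coefC addr0.
exists (v * q + c), (u + v * p); split.
- by rewrite rpredD ?rpredM.
- by rewrite rpredD ?rpredM.
rewrite hornerD hornerMX hornerC gz mulrDl -mulrA -expr2 zz; ring.
Qed.

(** Induction on the adjoined roots: in characteristic 2, (u + v s_i)^2 = u^2 + a_i v^2. *)
Lemma adjoin_sqrt_sqr (A : F -> Prop) n (a : 'I_n -> F) (s : 'I_n -> E) :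
  (forall i, s i ^+ 2 = (a i)%:A) ->
  (forall c d, A c -> A d -> A (c + d)) -> (forall c, A (c ^+ 2)) ->
  (forall i c, A c -> A (a i * c)) ->
  forall x, x \in <<1 & codom s>>%VS -> exists2 c, A c & x ^+ 2 = c%:A.
Proof.
move=> sP A_D A_sqr A_a; rewrite codomE; elim/last_ind: (enum 'I_n) => [|r i IHr] x.
  by rewrite adjoin_nil subfield_closed => /vlineP[c ->]; exists (c ^+ 2); rewrite // exprZn expr1n.
rewrite map_rcons adjoin_rcons => xK.
have [|u [v [/IHr[c Ac uE] /IHr[d Ad vE] ->]]] := @adjoin_quadratic <<1 & map s r>>%AS x (s i) _ xK.
  rewrite sP; apply: subvP (addvSl _ _) _ _.
  by rewrite memvZ // mem1v.
exists (c + a i * d); first by apply: A_D => //; apply: A_a.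
have E2 : 2%N \in [pchar E] by apply: (rmorph_pchar (in_alg E)) F2.
rewrite -[LHS](pFrobenius_autE E2) rmorphD /= !pFrobenius_autE exprMn uE vE sP.
rewrite scalerDl mulrC; congr (_ + _); exact/esym/(rmorphM (in_alg E)).
Qed.

Section Kernels.
Variables (K : {subfield E}) (T : F -> Prop) (P : Wq F -> Prop).
Hypothesis T_D : forall c d, T c -> T d -> T (c + d).
Hypothesis T_M : forall c d, T c -> T d -> T (c * d).
Hypothesis T_sqr : forall c, T (c ^+ 2).
Hypothesis P0 : P 0.
Hypothesis P_D : forall u v, P u -> P v -> P (u + v).
Hypothesis P_swap : forall c x y, T c -> P (br (x * c) y + br x (c * y)).
Hypothesis K_sqr : forall x, x \in K -> exists2 c, T c & x ^+ 2 = c%:A.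

Let algI : injective (in_alg E) := fmorph_inj (in_alg E).

Let K_sqr_fun m (S : 'I_m -> 'I_m -> E) : (forall i j, S i j \in K) ->
  exists N : 'I_m -> 'I_m -> F, forall i j, T (N i j) /\ S i j ^+ 2 = (N i j)%:A.
Proof.
move=> KS; have /choice[N NP] : forall ij : 'I_m * 'I_m,
    exists c, T c /\ S ij.1 ij.2 ^+ 2 = c%:A.
  by move=> ij; have [c] := K_sqr (KS ij.1 ij.2); exists c.
by exists (fun i j => N (i, j)) => i j; apply: (NP (i, j)).
Qed.

(** Allowing any M inside K makes the result apply to <<K; t>> as well when t lies in K. *)
Lemma Wq_ker_inseparable (M : {subfield E}) w : {subset M <= K} ->
  Wq_ker (in_alg (subvs_of M)) w -> P w.
Proof.
move=> MK /Wq_ker_subfield[m [al [be [S [MS S_sym alE ->]]]]].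
have [N NP] := K_sqr_fun (fun i j => MK _ (MS i j)).
have sqS i j : S i j ^+ 2 = in_alg E (N i j) by case: (NP i j).
(* This is S_ii computed inside F. *)
pose s i := al i - \sum_j be j * N i j.
have sE i : in_alg E (s i) = S i i.
  rewrite rmorphB rmorph_sum; apply/eqP; rewrite subr_eq; apply/eqP.
  rewrite [LHS]alE; congr (_ + _); apply: eq_bigr => j _.
  by rewrite sqS rmorphM.
apply: (diagonal_sum_mem P0 P_D P_swap (s := s) (N := N)) => [i j|i j|i|i].
- by apply: algI; rewrite -!sqS S_sym.
- by case: (NP i j).
- by apply: algI; rewrite -sqS -sE rmorphXn.
- by rewrite subrK.
Qed.

Variables (b : F) (G : Wq F -> Prop).
Hypothesis G_D : forall u v, G u -> G v -> G (u + v).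
Hypothesis P_G : forall u, P u -> G u.
Hypothesis G_scaled : forall c, c != 0 -> G (br (b * c) c^-1).

Lemma Wq_ker_artin_schreier t w : t ^+ 2 = t + b%:A ->
  Wq_ker (in_alg (subvs_of <<K; t>>%AS)) w -> G w.
Proof.
move=> tE; have [Kt|Kt] := boolP (t \in K).
  move=> kw; apply: P_G; apply: Wq_ker_inseparable kw => x.
  by move/Fadjoin_idP: Kt => /= ->.
case/Wq_ker_subfield=> m [al [be [S [LS S_sym alE ->]]]].
have KA c : c%:A \in K by rewrite memvZ // mem1v.
have tt : t ^+ 2 \in (K + K * <[t]>)%VS.
  rewrite tE addrC memv_add //; apply/memv_cosetP.
  by exists 1; rewrite ?mem1v ?mul1r.
have /choice[uv uvP] : forall ij : 'I_m * 'I_m, exists uv : E * E,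
    [/\ uv.1 \in K, uv.2 \in K & S ij.1 ij.2 = uv.1 + uv.2 * t].
  move=> ij; have [u [v uvE]] := adjoin_quadratic tt (LS ij.1 ij.2).
  by exists (u, v).
pose u i j := (uv (i, j)).1; pose v i j := (uv (i, j)).2.
have Ku i j : u i j \in K by case: (uvP (i, j)).
have Kv i j : v i j \in K by case: (uvP (i, j)).
have SE i j : S i j = u i j + v i j * t by case: (uvP (i, j)).
(* Since t is not in K, the elements 1 and t are independent over K. *)
have indep x y x' y' : x \in K -> y \in K -> x' \in K -> y' \in K ->
    x + y * t = x' + y' * t -> x = x' /\ y = y'.
  move=> Kx Ky Kx' Ky' xyE; have yy : y = y'.
    apply: contraNeq Kt; rewrite -subr_eq0 => y0.
    have -> : t = (x' - x) / (y - y').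
      apply: (mulfI y0); rewrite [RHS]mulrC divfK //; apply/eqP.
      rewrite -subr_eq0 (_ : _ - _ = (x + y * t) - (x' + y' * t)); last by ring.
      by rewrite xyE subrr.
    by rewrite rpred_div // rpredB.
  by move: xyE; rewrite yy => /addIr.
have uv_sym i j : u i j = u j i /\ v i j = v j i.
  by apply: indep => //; rewrite -!SE.
have [U UP] := K_sqr_fun Ku; have [V VP] := K_sqr_fun Kv.
have sqU i j : u i j ^+ 2 = in_alg E (U i j) by case: (UP i j).
have sqV i j : v i j ^+ 2 = in_alg E (V i j) by case: (VP i j).
pose d i := \sum_j be j * V i j.
pose s i := al i - b * d i - \sum_j be j * U i j.
have E2 : 2%N \in [pchar E] by apply: (rmorph_pchar (in_alg E)) F2.
have sqS i j : S i j ^+ 2 = in_alg E (U i j) + in_alg E (V i j) * (t + b%:A).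
  rewrite SE -(pFrobenius_autE E2) rmorphD rmorphM /= !pFrobenius_autE.
  by rewrite sqU sqV tE.
(* Compare the coefficients of 1 and t in the i-th equation, using S_ij^2 = U_ij + V_ij (t + b). *)
have coefs i : u i i = in_alg E (s i) /\ v i i = in_alg E (d i).
  apply: indep => //; try exact: KA.
  rewrite -SE; apply: (addIr (\sum_j (be j)%:A * S i j ^+ 2)); rewrite -alE.
  rewrite -[LHS]/(in_alg E (al i)).
  have -> : \sum_j (be j)%:A * S i j ^+ 2 =
      in_alg E (\sum_j be j * U i j) + in_alg E (d i) * (t + b%:A).
    rewrite /d !rmorph_sum mulr_suml -big_split; apply: eq_bigr => j _.
    by rewrite sqS mulrDr mulrA -!(rmorphM (in_alg E)).
  have -> : in_alg E (al i) = in_alg E (s i) + in_alg E b * in_alg E (d i)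
      + in_alg E (\sum_j be j * U i j).
    by rewrite -!rmorphM -!rmorphD; congr (in_alg E _); rewrite /s; ring.
  rewrite -[b%:A]/(in_alg E b).
  have tt0 : in_alg E (d i) * t + in_alg E (d i) * t = 0 by rewrite addrr_pchar2.
  by rewrite mulrDr -[LHS]addr0 -tt0; ring.
(* The first sum satisfies the diagonal system for [U]. The second is left to elimination on [V],
   with V_ii = d_i^2 because v_ii = d_i. *)
have -> : \sum_i br (al i) (be i) = \sum_i br (al i - b * d i) (be i)
    + \sum_(i in [set: 'I_m]%SET) br (b * d i) (be i).
  rewrite [X in _ + X](eq_bigl predT) => [|i]; last by rewrite finset.in_setT.
  by rewrite -big_split; apply: eq_bigr => i _ /=; rewrite -bracketDl subrK.
apply: G_D.
  apply: P_G; apply: (diagonal_sum_mem P0 P_D P_swap (s := s) (N := U)) => [i j|i j|i|i].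
  - by apply: algI; rewrite -!sqU (uv_sym i j).1.
  - by case: (UP i j).
  - by apply: algI; rewrite -sqU (coefs i).1 rmorphXn.
  - by rewrite subrK.
apply: (schur_sum_mem T_D T_M T_sqr P0 P_D P_swap G_D P_G G_scaled (N := V))
  => [i j|i j|i|i _].
- by apply: algI; rewrite -!sqV (uv_sym i j).2.
- by case: (VP i j).
- by apply: algI; rewrite -sqV (coefs i).2 rmorphXn.
- by apply: eq_bigl => j; rewrite finset.in_setT.
Qed.
End Kernels.
End Subfields.

(** * The reverse inclusions *)
Section ScalarExtensionOfProducts.
Variables (F L : fieldType) (f : {rmorphism F -> L}).

Lemma map_bform_subproof (B : bform F) :
  (map_mx f B)^T = map_mx f B /\ bnonsingular (map_mx f B).
Proof.
split; first by rewrite map_trmx bform_sym.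
by apply/bnonsingularP; rewrite map_unitmx; apply/bnonsingularP/bformP.
Qed.

Definition bmap (B : bform F) : bform L :=
  BForm (map_bform_subproof B).1 (map_bform_subproof B).2.

Lemma Wq_map_tens (B : bform F) w :
  Wq_map f (bclass B ⊗ w) = bclass (bmap B) ⊗ Wq_map f w.
Proof.
rewrite -[w]qclass_repr Wq_tensE !Wq_mapE Wq_tensE.
by apply/qclassP/qisom_qwitt; rewrite /= mxtens.map_mxT; apply: qisom_refl.
Qed.

Lemma Wq_tens_metabolic (B : bform L) w : metabolic B -> bclass B ⊗ w = 0.
Proof.
move=> mB; rewrite -[w]qclass_repr Wq_tensE.
have [k iso] := metabolic_tens (bform_sym B) (bformP B) mB (qformP (repr w)).
by apply: etrans (qclass_hyp L k); apply/qclassP/qisom_qwitt.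
Qed.

(** Over L the vector (r, 1) is isotropic for <1, a>_b, as r^2 + a = 2a = 0, so this bilinear form
    becomes metabolic. *)
Lemma Wq_map_pfister (F2 : 2%N \in [pchar F]) a (a0 : a != 0) (r : L) w :
  r ^+ 2 = f a -> Wq_map f (bpfister a0 ⊗ w) = 0.
Proof.
move=> ra; rewrite Wq_map_tens Wq_tens_metabolic //.
have L2 : 2%N \in [pchar L] by apply: rmorph_pchar F2.
exists 1, (\row_(i < 2) if i == 0 then r else 1); split=> //.
  apply/row_freeP; exists (delta_mx 1 0); apply/matrixP=> i j.
  by rewrite !ord1 -colE !mxE.
apply/matrixP=> i j; rewrite !ord1 /= map_diag_mx mul_mx_diag !mxE.
rewrite !big_ord_recl big_ord0 !mxE /= rmorph1 mulr1 mul1r mulr1 addr0 -expr2 ra.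
exact: addrr_pchar2.
Qed.

(** Over L the vector (t, 1) is isotropic for [1, b]. *)
Lemma Wq_map_bracket (F2 : 2%N \in [pchar F]) b (t : L) (beta : Wb F) :
  t ^+ 2 + t + f b = 0 -> Wq_map f (beta ⊗ qclass (bracket F2 1 b)) = 0.
Proof.
move=> tb; have L2 : 2%N \in [pchar L] by apply: rmorph_pchar F2.
rewrite -[beta]bclass_repr Wq_map_tens Wq_mapE.
have -> : qclass (qmap f (bracket F2 1 b)) = qclass (bracket L2 1 (f b)).
  apply/qclassP/qisom_qwitt; rewrite /= map_block_mx map_mx0 map_mx1.
  by rewrite !map_scalar_mx rmorph1; apply: qisom_refl.
rewrite (@bracket0_of_root _ _ _ _ t 1) ?raddf0 ?oner_neq0 ?orbT //.
by rewrite mul1r mulr1 expr1n mulr1.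
Qed.
End ScalarExtensionOfProducts.

(** The orthogonal sum of representatives serves as delta; hence the set of all beta ⊗ [1, b] is
    closed under addition. *)
Lemma Wb_tensD (F : fieldType) (beta gamma : Wb F) :
  exists delta : Wb F, forall w, delta ⊗ w = beta ⊗ w + gamma ⊗ w.
Proof.
exists (bclass (bsum (repr beta) (repr gamma))) => w.
rewrite -[beta in RHS]bclass_repr -[gamma in RHS]bclass_repr -[w]qclass_repr.
rewrite !Wq_tensE qclassD; apply/qclassP/qisom_qwitt/bisom_qisom/tens_osuml.
Qed.

Lemma Wb_tens0 (F : fieldType) : exists beta : Wb F, forall w, beta ⊗ w = 0.
Proof.
have s0 : all (fun a : F => a != 0) [::] by [].
exists (bclass (diagb s0)) => w; apply: Wq_tens_metabolic.
exists 0, 0; split=> //; first by rewrite /row_free mxrank0.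
by apply/matrixP=> -[].
Qed.

(** * Sums of additively closed sets *)

Section Sumsets.
Variable V : zmodType.
Implicit Types A B : set V.

Definition add_submonoid A := A 0 /\ forall u v, A u -> A v -> A (u + v).

Lemma sumset_submonoid A B :
  add_submonoid A -> add_submonoid B -> add_submonoid (sumset A B).
Proof.
move=> [A0 AD] [B0 BD]; split; first by exists 0 => //; exists 0; rewrite ?addr0.
move=> _ _ [u Au [v Bv <-]] [u' Au' [v' Bv' <-]].
exists (u + u'); first exact: AD.
by exists (v + v'); [exact: BD | rewrite addrACA].
Qed.

Lemma big_sumset_submonoid n (A : 'I_n -> set V) :
  (forall i, add_submonoid (A i)) ->
  add_submonoid (\big[@sumset _/[set 0]]_(i < n) A i).
Proof.
move=> subA; elim/big_ind: _ => //; last exact: sumset_submonoid.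
by split=> // _ _ -> ->; rewrite addr0.
Qed.

Lemma sub_big_sumset n (A : 'I_n -> set V) i :
  (forall i, add_submonoid (A i)) ->
  A i `<=` \big[@sumset _/[set 0]]_(i < n) A i.
Proof.
move=> subA u Au; rewrite (bigD1 i) //=; exists u => //; exists 0; rewrite ?addr0 //.
elim/big_ind: _ => // [X Y X0 Y0|j _]; last by case: (subA j).
by exists 0 => //; exists 0; rewrite ?addr0.
Qed.

Lemma big_sumset_sub n (A : 'I_n -> set V) B :
  add_submonoid B -> (forall i, A i `<=` B) ->
  \big[@sumset _/[set 0]]_(i < n) A i `<=` B.
Proof.
move=> [B0 BD] AB; elim/big_ind: _ => [_ ->|X Y XB YB _ [u /XB Bu [v /YB Bv <-]]|i _] //.
exact: BD.
Qed.

Lemma range_submonoid (U : zmodType) (h : {additive U -> V}) :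
  add_submonoid (range h).
Proof.
split; first by exists 0; rewrite ?raddf0.
by move=> _ _ [u _ <-] [v _ <-]; exists (u + v); rewrite ?raddfD.
Qed.

Lemma ker_submonoid (U : zmodType) (h : {additive V -> U}) :
  add_submonoid [set w | h w = 0].
Proof. by split=> [|u v /= hu hv]; rewrite /= ?raddf0 // raddfD hu hv addr0. Qed.
End Sumsets.

Theorem corollary4p7 (F : fieldType) (F2 : 2%N \in [pchar F])
    (n : nat) (a : 'I_n -> F) (a_neq0 : forall i, a i != 0) (b : F)
    (E : fieldExtType F)
    (s : 'I_n -> E) (sP : forall i, s i ^+ 2 = (a i)%:A)
    (t : E) (tP : root ('X^2 + 'X + (b%:A)%:P) t) :
  let K := <<1 & codom s>>%AS in
  let L := <<K; t>>%AS in
  let S := \big[@sumset _/[set 0]]_(i < n)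
             range (fun w : Wq F => bpfister (a_neq0 i) ⊗ w) in
  Wq_ker (in_alg (subvs_of K)) = S
  /\
  Wq_ker (in_alg (subvs_of L)) =
    sumset (range (fun beta : Wb F => beta ⊗ qclass (bracket F2 1 b))) S.
Proof.
move=> K L S.
have E2 : 2%N \in [pchar E] by apply: (rmorph_pchar (in_alg E)) F2.
pose S_i i := range (fun w : Wq F => bpfister (a_neq0 i) ⊗ w).
have sub_i i : add_submonoid (S_i i) by apply: range_submonoid.
have [S0 S_D] : add_submonoid S by apply: big_sumset_submonoid.
have S_pfister i w : S (bpfister (a_neq0 i) ⊗ w).
  by apply: (@sub_big_sumset _ _ S_i i) => //; exists w.
pose br x y := qclass (bracket F2 x y).
(* [A] collects the scalars that can change slots modulo [S]. *)
pose A c := forall x y, S (br (x * c) y + br x (c * y)).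
have A_D c d : A c -> A d -> A (c + d).
  move=> Ac Ad x y; rewrite /br mulrDr mulrDl bracketDl bracketDr addrACA.
  exact: S_D (Ac x y) (Ad x y).
have A_sqr c : A (c ^+ 2).
  by move=> x y; rewrite /br bracket_sqr bracketFF; apply: S0.
have A_a i c : A c -> A (a i * c).
  move=> Ac x y.
  (* The symbol [x a_i, c y] is inserted twice; then the first pair is in [S] by [Ac], and the
     second is <1, a_i>_b ⊗ [c y, a_i x]. *)
  have -> : br (x * (a i * c)) y + br x (a i * c * y) =
      (br (x * a i * c) y + br (x * a i) (c * y)) +
      (br (a i * (c * y)) x + br (c * y) (a i * x)).
    have brC u v : br u v = br v u by apply: bracketC.
    have brFF u v : br u v + br u v = 0 by apply: bracketFF.
    by rewrite (brC (c * y)) [a i * x]mulrC [br (a i * _) x + _]addrC -addrA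
      (addrA (br (x * a i) _)) brFF add0r (brC (a i * _)) !mulrA.
  by apply: S_D; [exact: Ac | rewrite /br -(bpfister_bracket F2 (a_neq0 i))].
(* Squaring is additive in characteristic 2, so [T] is closed under sums and products; [K_A] below
   places it inside [A]. *)
pose T c := exists2 x, x \in K & x ^+ 2 = c%:A.
have T_D c d : T c -> T d -> T (c + d).
  case=> x Kx xc [y Ky yd]; exists (x + y); first exact: rpredD.
  by rewrite -(pFrobenius_autE E2) rmorphD /= !pFrobenius_autE xc yd scalerDl.
have T_M c d : T c -> T d -> T (c * d).
  case=> x Kx xc [y Ky yd]; exists (x * y); first exact: rpredM.
  by rewrite exprMn xc yd; apply/esym/(rmorphM (in_alg E)).
have T_sqr c : T (c ^+ 2).
  by exists c%:A; rewrite ?memvZ ?mem1v // exprZn expr1n.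
have K_A x : x \in K -> exists2 c, A c & x ^+ 2 = c%:A.
  exact: adjoin_sqrt_sqr.
have S_swap c x y : T c -> S (br (x * c) y + br x (c * y)).
  case=> z /K_A[d Ad ->] /(fmorph_inj (in_alg E)) <-; exact: Ad.
have K_sqr x : x \in K -> exists2 c, T c & x ^+ 2 = c%:A.
  by move=> Kx; have [c _ xc] := K_A x Kx; exists c => //; exists x.
have S_ker (M : {subfield E}) : {subset K <= M} -> S `<=` Wq_ker (in_alg (subvs_of M)).
  move=> KM; apply: big_sumset_sub; first exact: ker_submonoid.
  move=> i _ [w _ <-]; have Ms : s i \in M by rewrite KM // seqv_sub_adjoin ?codom_f.
  apply: (@Wq_map_pfister _ _ _ F2 _ _ (Subvs Ms)); rewrite expr2; apply: val_inj.
  by apply: etrans (esym (vsval_alg M _)); rewrite -sP expr2.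
split; apply/seteqP; split.
- by move=> w; apply: (Wq_ker_inseparable S0 S_D S_swap K_sqr).
- exact: S_ker.
- have tE : t ^+ 2 = t + b%:A.
    move: tP; rewrite /root !hornerE => /eqP.
    by rewrite -addrA => /eqP; rewrite addr_eq0 oppr_pchar2 // => /eqP.
  have [R0 R_D] : add_submonoid (range (fun beta : Wb F => beta ⊗ br 1 b)).
    split; first by have [z zE] := Wb_tens0 F; exists z.
    move=> _ _ [u _ <-] [v _ <-]; have [z zE] := Wb_tensD u v.
    by exists z.
  have [_ G_D] := sumset_submonoid (conj R0 R_D) (conj S0 S_D).
  move=> w; apply: (Wq_ker_artin_schreier T_D T_M T_sqr S0 S_D S_swap K_sqr (b := b))
    => // [u Su|c c0].
    by exists 0 => //; exists u; rewrite ?add0r.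
  have [z zE] := scaled_bracket_mem F2 b c0.
  by exists (br (b * c) c^-1); [exists z | exists 0; rewrite ?addr0].
- move=> _ [_ [beta _ <-] [w Sw <-]].
  have [_ ker_D] := ker_submonoid (Wq_map (in_alg (subvs_of L))).
  apply: ker_D; last by apply: S_ker Sw => x Kx; apply: subvP (subv_adjoin _ _) _ Kx.
  have Lt : t \in L by apply: memv_adjoin.
  apply: (@Wq_map_bracket _ _ _ F2 _ (Subvs Lt)); rewrite expr2; apply: val_inj.
  move: tP; rewrite /root !hornerE => /eqP tb.
  rewrite -[RHS]tb expr2; congr (_ + _); exact: vsval_alg.
Qed.
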